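(* Let $H$ be a Krull monoid whose class group $\mathcal C(H)$ is free abelian with basis $(e_1,\ldots,e_r)$ for some $r\ge 2$, and let $G_P\subset\mathcal C(H)$ denote the set of classes containing prime divisors. Let $G_r^+=\{\sum_{i=1}^r\epsilon_ie_i:\epsilon_i\in\{0,1\},\text{ not all }\epsilon_i=0\}$. Suppose that $G_P$ is finite and that $G_P=-G_P$ with $G_P\supset G_r^+$. 1. There exists $M\in\mathbb N_0$ such that, for each $k\ge 2$, $\mathcal U_k(H)=L'\cup L^*\cup L''$, where $L^*$ is an interval, $L'\subset\min L^*+[-M,-1]$, and $L''\subset\max L^*+[1,M]$. 2. For each $k\in\mathbb N$, $$\rho_{2k}(H)=k\,\mathsf D(G_P)\ge k\,\mathsf F_{r+2}\quad\text{and}\quad k\,\mathsf D(G_P)+1\le\rho_{2k+1}(H)\le k\,\mathsf D(G_P)+\frac{\mathsf D(G_P)}{2},$$ where $\mathsf F_n$ denotes the $n$-th Fibonacci number. Upper bounds for $\mathsf D(G_P)$, and hence for each $\rho_k(H)$, then follow from the following result: for $r\ge 2$ and $G_0=G_r^+\cup -G_r^+$, $$\mathsf F_{r+2}\le\mathsf D(G_0)\le\frac{2^r-r-1}{2^r}(r+2)^{\frac{r+2}{2}}\le(r+2)^{\frac{r+2}{2}}.$$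
   Context: $\mathbb N$ is the set of positive integers, $\mathbb N_0=\mathbb N\cup\{0\}$, and $[a,b]$ denotes the set of integers $x$ with $a\le x\le b$; an interval is a nonempty finite set of consecutive integers. Fibonacci numbers: $\mathsf F_0=0$, $\mathsf F_1=1$, $\mathsf F_n=\mathsf F_{n-1}+\mathsf F_{n-2}$ for $n\ge 2$. A monoid is a commutative cancellative semigroup with identity. For a monoid $H$, $H^\times$ is its group of units, $\mathsf q(H)$ its quotient group; an atom is a non-unit $u$ such that $u=ab$ implies $a\in H^\times$ or $b\in H^\times$. $\mathcal F(P)$ is the free abelian monoid with basis $P$. A homomorphism $\varphi:H\to D$ is a divisor homomorphism if $\varphi(a)\mid\varphi(b)$ implies $a\mid b$; it is a divisor theory if moreover $D=\mathcal F(P)$ for some set $P$ and every $a\in\mathcal F(P)$ is $\gcd(\varphi(X))$ for some finite nonempty $X\subset H$. $H$ is a Krull monoid if it has a divisor homomorphism into a free abelian monoid; then it has a divisor theory $\varphi:H\to\mathcal F(P)$, unique up to isomorphism. Its class group is $\mathcal C(H)=\mathsf q(\mathcal F(P))/\mathsf q(\varphi(H))$, written additively, and $G_P=\{p\,\mathsf q(\varphi(H)):p\in P\}$ is the set of classes containing prime divisors. For $a\in H$, $\mathsf L(a)$ is the set of all $n\in\mathbb N_0$ such that $a$ is, up to a unit, a product of $n$ atoms. For $k\in\mathbb N$, $\mathcal U_k(H)$ is the union of all sets $\mathsf L(a)$, $a\in H$, with $k\in\mathsf L(a)$ (and $\mathcal U_k(H)=\{k\}$ if $H=H^\times$), and $\rho_k(H)=\sup\mathcal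 U_k(H)$. For a subset $G_0$ of an abelian group, $\mathsf D(G_0)$ is the Davenport constant: the supremum of the lengths of minimal zero-sum sequences over $G_0$, i.e. nonempty finite multisets of elements of $G_0$ with sum $0$ and no proper nonempty sub-multiset with sum $0$. *)

(* Defs.v *)
From HB Require Import structures.
From mathcomp Require Import all_boot all_order all_algebra.
From mathcomp Require Import finmap multiset.
From mathcomp Require Import all_classical all_reals all_analysis.

Set Implicit Arguments.
Unset Strict Implicit.
Unset Printing Implicit Defensive.

Import Order.TTheory GRing.Theory Num.Theory.

Local Open Scope classical_set_scope.
Local Open Scope ring_scope.

HB.mixin Record Monoid_isCancComm M of monoid.Monoid M := {
  cmulgC : commutative ( *%g : M -> M -> M);
  cmulgI : forall x : M, injective ( *%g x)
}.

#[short(type="ccMonoidType")]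
HB.structure Definition CancCommMonoid :=
  {M of Monoid_isCancComm M & monoid.Monoid M}.

Definition munit (H : ccMonoidType) (a : H) : Prop :=
  exists b : H, (a * b = 1)%g.

Definition matom (H : ccMonoidType) (u : H) : Prop :=
  ~ munit u /\ forall a b : H, (u = a * b)%g -> munit a \/ munit b.

Definition mdivides (H : ccMonoidType) (a b : H) : Prop :=
  exists c : H, (b = a * c)%g.

Definition is_mgcd (H : ccMonoidType) (X : set H) (d : H) : Prop :=
  (forall x, X x -> mdivides d x) /\
  (forall c, (forall x, X x -> mdivides c x) -> mdivides c d).

(* The free abelian monoid with basis P: the product is the sum of multisets. *)

Definition free_abmon (P : choiceType) : Type := {mset P}%mset.

HB.instance Definition _ (P : choiceType) := Choice.on (free_abmon P).

Section FreeAbMon.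
Variable P : choiceType.
Local Open Scope mset_scope.

Definition fam_mul (A B : free_abmon P) : free_abmon P := A `+` B.
Definition fam_one : free_abmon P := mset0.

Fact fam_mulA : associative fam_mul.
Proof. by move=> A B C; apply/msetP => x; rewrite !msetE2 addnA. Qed.

Fact fam_mul1 : left_id fam_one fam_mul.
Proof. by move=> A; apply/msetP => x; rewrite msetE2 mset0E add0n. Qed.

Fact fam_mulC : commutative fam_mul.
Proof. by move=> A B; apply/msetP => x; rewrite !msetE2 addnC. Qed.

Fact fam_mulr1 : right_id fam_one fam_mul.
Proof. by move=> A; rewrite fam_mulC fam_mul1. Qed.

HB.instance Definition _ :=
  isMonoid.Build (free_abmon P) fam_mulA fam_mul1 fam_mulr1.

Fact fam_mulI (A : free_abmon P) : injective ( *%g A).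
Proof.
move=> B C /msetP eqBC; apply/msetP => x; apply/eqP.
by have := eqBC x; rewrite !msetE2 => /eqP; rewrite eqn_add2l.
Qed.

HB.instance Definition _ :=
  Monoid_isCancComm.Build (free_abmon P) fam_mulC fam_mulI.

Definition fam_gen (p : P) : free_abmon P := [mset p].

End FreeAbMon.

(* The quotient group q(M) is written additively although M is multiplicative,
   so that class groups are zmodTypes. *)

Section QuotientGroup.
Variable M : ccMonoidType.
Implicit Types x y z : M * M.

(* The pair (a, b) stands for the fraction a / b. *)
Definition frac_equiv x y := (x.1 * y.2 == y.1 * x.2)%g.

Fact frac_equiv_is_equiv : equiv_class_of frac_equiv.
Proof.
rewrite /frac_equiv; split=> [x|x y|y x z]; first exact: eqxx.
  by rewrite eq_sym.
move=> /eqP xy /eqP yz; apply/eqP/(@cmulgI _ y.2).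
rewrite mulgA (cmulgC y.2 x.1) xy -mulgA (cmulgC x.2) mulgA yz.
by rewrite -(cmulgC y.2) -mulgA.
Qed.

Canonical frac_equiv_equiv := EquivRelPack frac_equiv_is_equiv.
Canonical frac_equiv_encModRel := defaultEncModRel frac_equiv.

Definition quot_group : Type := {eq_quot frac_equiv}%qT.

HB.instance Definition _ : EqQuotient (M * M)%type frac_equiv quot_group :=
  EqQuotient.on quot_group.
HB.instance Definition _ := Choice.on quot_group.

Definition mk_frac (a b : M) : quot_group := (\pi_quot_group (a, b))%qT.

Definition qg_zero : quot_group := mk_frac 1%g 1%g.
Definition qg_opp (u : quot_group) : quot_group :=
  mk_frac (repr u).2 (repr u).1.
Definition qg_add (u v : quot_group) : quot_group :=
  mk_frac ((repr u).1 * (repr v).1)%g ((repr u).2 * (repr v).2)%g.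

Fact mk_fracP a b c d : mk_frac a b = mk_frac c d <-> (a * d = c * b)%g.
Proof. by split=> [/eqmodP/eqP|abcd]; last apply/eqmodP/eqP. Qed.

Fact mk_frac_repr u : mk_frac (repr u).1 (repr u).2 = u.
Proof. by rewrite /mk_frac -surjective_pairing reprK. Qed.

Let mulgACA (a b c d : M) : (a * b * (c * d) = a * c * (b * d))%g.
Proof. by rewrite -!mulgA (mulgA b) (cmulgC b c) -mulgA. Qed.

Fact qg_addE a b c d :
  qg_add (mk_frac a b) (mk_frac c d) = mk_frac (a * c)%g (b * d)%g.
Proof.
apply/mk_fracP; rewrite mulgACA [RHS]mulgACA.
by congr (_ * _)%g; apply/mk_fracP; rewrite mk_frac_repr.
Qed.

Fact qg_oppE a b : qg_opp (mk_frac a b) = mk_frac b a.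
Proof.
apply/mk_fracP; rewrite cmulgC (cmulgC b).
by apply/esym/mk_fracP; rewrite mk_frac_repr.
Qed.

Fact qg_addA : associative qg_add.
Proof.
move=> u v w; rewrite -[u]mk_frac_repr -[v]mk_frac_repr -[w]mk_frac_repr.
by rewrite !qg_addE !mulgA.
Qed.

Fact qg_addC : commutative qg_add.
Proof. by move=> u v; rewrite /qg_add cmulgC [X in mk_frac _ X]cmulgC. Qed.

Fact qg_add0 : left_id qg_zero qg_add.
Proof. by move=> u; rewrite -[u]mk_frac_repr qg_addE !mul1g. Qed.

Fact qg_addN : left_inverse qg_zero qg_opp qg_add.
Proof.
move=> u; rewrite -[u]mk_frac_repr qg_oppE qg_addE.
by apply/mk_fracP; rewrite mulg1 mul1g cmulgC.
Qed.

HB.instance Definition _ :=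
  GRing.isZmodule.Build quot_group qg_addA qg_addC qg_add0 qg_addN.

End QuotientGroup.

Notation monoid_hom H D := (UMagmaMorphism.type H D).

Definition divisor_hom (H D : ccMonoidType) (phi : monoid_hom H D) : Prop :=
  forall a b : H, mdivides (phi a) (phi b) -> mdivides a b.

Definition krull (H : ccMonoidType) : Prop :=
  exists (P : choiceType) (phi : monoid_hom H (free_abmon P)), divisor_hom phi.

Definition divisor_theory (H : ccMonoidType) (P : choiceType)
    (phi : monoid_hom H (free_abmon P)) : Prop :=
  divisor_hom phi /\
  forall a : free_abmon P, exists X : set H,
    [/\ finite_set X, X !=set0 & is_mgcd (phi @` X) a].

Section ClassGroup.
Variables (H : ccMonoidType) (P : choiceType).
Variable phi : monoid_hom H (free_abmon P).

(* The subgroup q(phi(H)) of q(F(P)). *)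
Definition principal : {pred quot_group (free_abmon P)} :=
  [pred u | `[< exists a b : H, u = mk_frac (phi a) (phi b) >]].

Fact principal_zmod_closed : zmod_closed principal.
Proof.
split=> [|u v].
  by apply/asboolP; exists 1%g, 1%g; rewrite gmulf1.
move=> /asboolP[a [b ->]] /asboolP[c [d ->]]; apply/asboolP.
exists (a * d)%g, (b * c)%g.
by rewrite [- _]qg_oppE [LHS]qg_addE !gmulfM.
Qed.

HB.instance Definition _ :=
  GRing.isZmodClosed.Build (quot_group (free_abmon P)) principal
    principal_zmod_closed.

Definition class_group : zmodType := Quotient.quot principal.

Definition divisor_class (a : free_abmon P) : class_group :=
  (\pi_(Quotient.quot principal) (mk_frac a 1%g))%qT.

Definition prime_classes : set class_group := range (divisor_class \o @fam_gen P).

End ClassGroup.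

Arguments divisor_class {H P} phi a.
Arguments prime_classes {H P} phi.

Definition lengths (H : ccMonoidType) (a : H) : set nat :=
  [set n | exists (e : H) (s : n.-tuple H),
     [/\ munit e, forall i, matom (tnth s i)
       & (a = e * \prod_(i < n) tnth s i)%g]].

(* The first disjunct is the convention U_k(H) = {k} when H is a group. *)
Definition union_lengths (H : ccMonoidType) (k : nat) : set nat :=
  [set n | (forall a : H, munit a) /\ n = k \/
           ~ (forall a : H, munit a) /\
             exists a : H, lengths a k /\ lengths a n].

Definition nat_sup (R : realType) (A : set nat) : \bar R :=
  ereal_sup [set (n%:R)%:E | n in A].

Definition rho (R : realType) (H : ccMonoidType) (k : nat) : \bar R :=
  nat_sup R (union_lengths H k).

Definition minimal_zero_sum (G : zmodType) (G0 : set G) (S : {mset G}%mset) :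
    Prop :=
  [/\ S <> mset0, forall g, g \in S -> G0 g, \sum_(g <- S) g = 0
    & forall T : {mset G}%mset, mproper T S -> T <> mset0 ->
        \sum_(g <- T) g <> 0].

Definition davenport (R : realType) (G : zmodType) (G0 : set G) : \bar R :=
  nat_sup R [set size S | S in [set S | minimal_zero_sum G0 S]].

Definition is_Zbasis (G : zmodType) (r : nat) (e : 'I_r -> G) : Prop :=
  forall x : G, exists! c : {ffun 'I_r -> int}, x = \sum_(i < r) e i *~ c i.

(* The set G_r^+ of nonempty subset sums of the basis. *)
Definition pos_sums (G : zmodType) (r : nat) (e : 'I_r -> G) : set G :=
  [set x | exists eps : 'I_r -> bool,
     (exists i, eps i) /\ x = \sum_(i < r) e i *+ eps i].

Definition oppset (G : zmodType) (A : set G) : set G := -%R @` A.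

Fixpoint fib (n : nat) : nat :=
  match n with
  | 0 => 0
  | 1 => 1
  | (m.+1 as n1).+1 => fib n1 + fib m
  end%N.

(* Main.v *)
Require Import Defs.
From HB Require Import structures.
From mathcomp Require Import all_boot all_order all_algebra.
From mathcomp Require Import finmap multiset.
From mathcomp Require Import all_classical all_reals all_analysis.
From mathcomp Require Import ring lra zify.

(* An atom of H is the same thing as a minimal zero-sum sequence over G_P, read
   off the classes of the primes of phi(u), so sets of lengths can be computed
   with zero-sum sequences.

   Davenport constant: the multiplicity vector x of a minimal zero-sum sequence
   is a nonnegative kernel vector of the matrix A of coordinates.  Subtracting
   circuits greedily writes x as a nonnegative combination of at most
   n - rank A nonnegative integral circuits, and minimality forces all
   coefficients to be at most 1 (or x to be a circuit).  By Cramer's rule the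
   l1-norm of a circuit is a minor of [1 | A].  This gives finiteness of D(G_P),
   and for 0/1 vectors up to sign Hadamard's inequality bounds the minors.  The
   lower bound comes from a sequence with multiplicities 1, F_1, ..., F_r.

   Unions of lengths: if S is minimal zero-sum of length D, then S(-S) is also a
   product of the D pairs g(-g), so 2 and D are lengths of a common element;
   likewise 2 and 3.  Products of such elements fill an interval up to bounded
   error on both sides of the bound 2n <= k D, valid for k, n lengths of a common
   element. *)

Set Implicit Arguments.
Unset Strict Implicit.
Unset Printing Implicit Defensive.

Import Order.TTheory GRing.Theory Num.Theory.

Local Open Scope classical_set_scope.
Local Open Scope ring_scope.

(** * Hadamard's inequality *)

(* Orthogonalising the other rows against the first one keeps the determinant
   and does not increase the diagonal of the Gram matrix. *)
Lemma det_gram_bound (F : realFieldType) n p (M : 'M[F]_(n, p)) :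
  0 <= \det (M *m M^T) <= \prod_i (M *m M^T) i i.
Proof.
elim: n M => [|n IHn] M; first by rewrite det_mx00 big_ord0 ler01 lexx.
rewrite -[M](vsubmxK (m1 := 1)); move: (usubmx _) (dsubmx _) => v W {M}.
have dot_ge0 q s (X : 'M[F]_(q, s)) i : 0 <= (X *m X^T) i i.
  by rewrite mxE sumr_ge0 // => j _; rewrite mxE -expr2 sqr_ge0.
have diag_ge0 : 0 <= \prod_i (col_mx v W *m (col_mx v W)^T) i i.
  by apply: prodr_ge0 => i _; apply: dot_ge0.
set a := (v *m v^T) 0 0; have aE : v *m v^T = a%:M by apply: mx11_scalar.
(* A zero first row makes the determinant vanish; otherwise its squared length [a] can be inverted
   for the projection below. *)
have [a0 | a_neq0] := eqVneq a 0.
  have v0 : v = 0.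
    apply/rowP => j; rewrite [RHS]mxE; apply/eqP; rewrite -sqrf_eq0; apply/eqP.
    have sq_ge0 k : true -> 0 <= v 0 k * v^T k 0 by rewrite mxE -expr2 sqr_ge0.
    have /(psumr_eq0P sq_ge0)/(_ j isT) : \sum_k v 0 k * v^T k 0 = 0.
      by rewrite -[RHS]a0 /a [RHS]mxE.
    by rewrite mxE -expr2.
  suff -> : \det (col_mx v W *m (col_mx v W)^T) = 0 by rewrite lexx.
  by rewrite v0 tr_col_mx mul_col_row mul0mx trmx0 mulmx0 mul0mx det_ublock
    det0 mul0r.
have a_gt0 : 0 < a by rewrite lt_def a_neq0 dot_ge0.
(* The rows of [W] are projected orthogonally to [v], so the Gram matrix of [col_mx v W'] is block
   diagonal. *)
pose W' := W - a^-1 *: (W *m v^T *m v).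
have W'v : W' *m v^T = 0.
  by rewrite mulmxBl -scalemxAl -[_ *m v *m _]mulmxA aE mul_mx_scalar scalerA mulVf //
    scale1r subrr.
pose E : 'M[F]_(1 + n) := block_mx 1%:M 0 (- (a^-1 *: (W *m v^T))) 1%:M.
have detE : \det E = 1 by rewrite det_lblock !det1 mulr1.
have EM : E *m col_mx v W = col_mx v W'.
  by rewrite mul_block_col !mul1mx mul0mx addr0 mulNmx -scalemxAl addrC.
have -> : \det (col_mx v W *m (col_mx v W)^T) = a * \det (W' *m W'^T).
  transitivity (\det (col_mx v W' *m (col_mx v W')^T)).
    by rewrite -EM trmx_mul !mulmxA det_mulmx det_tr detE mulr1 -mulmxA det_mulmx
      detE mul1r.
  rewrite tr_col_mx mul_col_row.
  have -> : v *m W'^T = 0 by rewrite -[v]trmxK -trmx_mul W'v trmx0.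
  by rewrite W'v det_ublock aE det_scalar expr1.
have /andP[det_ge0 det_le] := IHn W'.
have -> : \prod_i (col_mx v W *m (col_mx v W)^T) i i = a * \prod_i (W *m W^T) i i.
  rewrite -[LHS]/(\prod_(i < 1 + n)
    (col_mx v W *m (col_mx v W)^T : 'M[F]_(1 + n)) i i).
  rewrite big_split_ord big_ord1 tr_col_mx mul_col_row block_mxEul; congr (_ * _).
  by apply: eq_bigr => i _; rewrite block_mxEdr.
rewrite mulr_ge0 ?(ltW a_gt0) //= ler_wpM2l ?(ltW a_gt0) //.
apply: le_trans det_le _; apply: ler_prod => i _; rewrite dot_ge0 /=.
(* Pythagoras: the two Gram matrices differ by a positive semidefinite rank-one term, whose diagonal
   is nonnegative. *)
have -> : W *m W^T = W' *m W'^T + a^-1 *: (W *m v^T *m (W *m v^T)^T).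
  rewrite -{1 2}[W](subrK (a^-1 *: (W *m v^T *m v))) -/W'.
  rewrite [(W' + _)^T]linearD /= mulmxDl !mulmxDr linearZ /= -!scalemxAr -!scalemxAl.
  rewrite [(_ *m v)^T]trmx_mul [W' *m (_ *m _)]mulmxA W'v mul0mx scaler0 addr0.
  have -> : W *m v^T *m v *m W'^T = 0.
    by rewrite -mulmxA -[v *m _]trmxK trmx_mul trmxK W'v trmx0 mulmx0.
  rewrite scaler0 add0r -[_ *m v *m _]mulmxA [v *m (_ *m _)]mulmxA aE mul_scalar_mx.
  by rewrite -scalemxAr !scalerA -mulrA mulVf // mulr1.
by rewrite [leRHS]mxE lerDl mxE mulr_ge0 ?dot_ge0 //
  invr_ge0 ltW.
Qed.

(** The diagonal Gram entries are sums of [n] squares, each at most 1, and the Gram determinant is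
    the square of [\det M]. *)
Lemma det_unit_entries_bound (F : realFieldType) n (M : 'M[F]_n) :
  (forall i j, `|M i j| <= 1) -> \det M ^+ 2 <= (n ^ n)%N%:R.
Proof.
move=> M_le1; have /andP[_] := det_gram_bound M.
rewrite det_mulmx det_tr -expr2 => /le_trans; apply.
have -> : (n ^ n)%N%:R = \prod_(i < n) n%:R :> F by rewrite prodr_const card_ord natrX.
apply: ler_prod => i _; rewrite mxE sumr_ge0 /= => [|j _]; last first.
  by rewrite mxE -expr2 sqr_ge0.
have -> : n%:R = \sum_(j < n) 1 :> F by rewrite sumr_const card_ord.
apply: ler_sum => j _; rewrite mxE -expr2 -real_normK ?num_real //.
by rewrite expr_le1.
Qed.

(** * Circuits of integral matrices *)

Lemma sum_inj_support (V : nmodType) (I J : finType) (f : J -> I) (G : I -> V) :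
  injective f -> (forall i, G i != 0 -> exists j, i = f j) ->
  \sum_i G i = \sum_j G (f j).
Proof.
move=> f_inj f_supp; rewrite (bigID (mem (f @: predT))) /= [X in _ + X]big1.
  rewrite addr0 big_imset /=; last by move=> i j _ _ /f_inj.
  by [].
move=> i; have [//|/f_supp[j ->]] := eqVneq (G i) 0.
by rewrite imset_f.
Qed.

Section Circuits.
Variables (F : realFieldType) (n r : nat) (A : 'M[int]_(n, r)).

Let AF : 'M[F]_(n, r) := map_mx intr A.
(** The column of ones records the l1-norm of a nonnegative row vector as the first coordinate of
    its product with this matrix. *)
Let A1 : 'M[int]_(n, 1 + r) := row_mx (const_mx 1) A.

(** Only minors through the column of ones matter: Cramer's rule yields no others here, and the
    estimate for 0/1 vectors up to sign exploits that column. *)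
Definition bounds_minors (C : F) : Prop :=
  forall m (f : 'I_m -> 'I_n) (h : 'I_m -> 'I_(1 + r)),
    injective f -> injective h -> (exists k, h k = ord0) ->
    `|\det (mxsub f h A1)|%:~R <= C.

Implicit Types (x w : 'rV[F]_n) (c : 'I_n -> nat).

(** The ratio test of the simplex method: [t] is the least [x 0 i / w 0 i] over the positive entries
    of [w]. *)
Lemma max_nonneg_step x w :
  (forall i, 0 <= x 0 i) -> (exists i, 0 < w 0 i) ->
  exists2 t, 0 <= t & (forall i, 0 <= (x - t *: w) 0 i) /\
    exists2 i, 0 < w 0 i & (x - t *: w) 0 i = 0.
Proof.
move=> x_ge0 [i0 wi0].
have [i wi /= i_min] := arg_minP (P := fun i => 0 < w 0 i) (fun i => x 0 i / w 0 i) wi0.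
exists (x 0 i / w 0 i); first by rewrite divr_ge0 // ltW.
split=> [j|]; last by exists i => //; rewrite !mxE divfK ?subrr // gt_eqF.
rewrite !mxE subr_ge0; have [wj|wj] := ltP 0 (w 0 j).
  by rewrite -ler_pdivlMr // i_min.
by apply: le_trans (x_ge0 j); rewrite mulr_ge0_le0 // divr_ge0 // ltW.
Qed.

(* Row freeness of [1 | A] on the support makes x / l1(x) the unique solution of
   y [1 | A] = (1, 0, .., 0); Cramer's rule on an invertible square submatrix M
   shows that |det M| x / l1(x) is integral, of l1-norm |det M|. *)
Lemma circuit_of_row_free x m (f : 'I_m -> 'I_n) (C : F) :
  bounds_minors C -> (forall i, 0 <= x 0 i) -> x != 0 -> x *m AF = 0 ->
  injective f -> (forall i, x 0 i != 0 -> exists j, i = f j) ->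
  row_free (rowsub f (map_mx intr A1 : 'M[F]_(n, 1 + r))) ->
  exists2 c, (exists2 t, 0 < t & forall i, (c i)%:R = t * x 0 i)
    & (\sum_i c i)%:R <= C.
Proof.
move=> bndC x_ge0 x_neq0 xA f_inj f_supp; set B := rowsub f _ => Bfree.
pose l := \sum_i x 0 i.
have l_gt0 : 0 < l.
  rewrite lt_def sumr_ge0 // andbT; apply: contraNneq x_neq0 => l0.
  by apply/eqP/rowP => i; rewrite mxE; apply: (psumr_eq0P _ l0).
pose y := colsub f x.
have yB j : (y *m B) 0 j = (j == ord0)%:R * l.
  have -> : (y *m B) 0 j = (x *m map_mx intr A1) 0 j.
    rewrite !mxE [RHS](sum_inj_support f_inj) => [|i].
      by apply: eq_bigr => i _; rewrite !mxE.
    by have [->|/f_supp //] := eqVneq (x 0 i) 0; rewrite mul0r eqxx.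
  rewrite map_row_mx mul_mx_row xA; case: (split_ordP j) => k ->.
    rewrite row_mxEl ord1 mxE mul1r; apply: eq_bigr => i _.
    by rewrite !mxE mulr1.
  by rewrite row_mxEr mxE mul0r.
(* Independence of the rows of [B] allows [m] independent columns to be selected, giving an
   invertible square submatrix. *)
have BTfull : row_full B^T by rewrite /row_full mxrank_tr.
pose h := fullrankfun BTfull; pose M := mxsub f h A1.
have h_inj : injective h by apply: fullrankfun_inj.
pose MF : 'M[F]_m := map_mx intr M.
have MFE : MF = colsub h B by apply/matrixP => i j; rewrite !mxE.
have detMF : \det MF = (\det M)%:~R by rewrite det_map_mx.
have MF_unit : MF \in unitmx.
  have <- : (rowsub h B^T)^T = MF by rewrite MFE; apply/matrixP => i j; rewrite !mxE.
  by rewrite unitmx_tr -row_free_unit; apply: fullrowsub_free.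
have detM_neq0 : \det M != 0.
  by move: MF_unit; rewrite unitmxE unitfE detMF intr_eq0.
have yM : forall j, (y *m MF) 0 j = (h j == ord0)%:R * l.
  move=> j; rewrite -yB MFE !mxE; apply: eq_bigr => i _; by rewrite !mxE.
(* Were the column of ones not selected, [y *m MF] would vanish, hence [y], hence [x]. *)
have /existsP[k /eqP hk] : [exists k, h k == ord0].
  apply: contraNT x_neq0; rewrite negb_exists => /forallP hN.
  have y0 : y = 0.
    apply: (can_inj (mulmxK MF_unit)); rewrite mul0mx; apply/rowP => j.
    by rewrite yM (negPf (hN j)) mul0r mxE.
  apply/eqP/rowP => i; rewrite mxE; have [//|/f_supp[j ->]] := eqVneq (x 0 i) 0.
  by have /rowP/(_ j) := y0; rewrite !mxE.
(* Multiplying [y *m MF], which is [l] times a unit vector, by the adjugate expresses [y] through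
   integral cofactors. *)
have yadj j : y 0 j * (\det M)%:~R = l * (\adj M k j)%:~R.
  have /rowP/(_ j) : y *m MF *m \adj MF = y *m (\det MF)%:M.
    by rewrite -mulmxA mul_mx_adj.
  rewrite mul_mx_scalar detMF [RHS]mxE [RHS]mulrC => <-; rewrite mxE (bigD1 k) //=.
  rewrite yM hk eqxx mul1r big1 ?addr0 -?map_mx_adj ?mxE // => i ik.
  by rewrite yM -hk (inj_eq h_inj) (negPf ik) !mul0r.
pose t := `|\det M|%:~R / l.
have t_gt0 : 0 < t by rewrite divr_gt0 // ltr0z normr_gt0.
have [c cE] : exists c, forall i, (c i)%:R = t * x 0 i.
  apply: (@fin_all_exists _ (fun=> nat) (fun i ci => ci%:R = t * x 0 i)) => i.
  have [->|/f_supp[j ->]] := eqVneq (x 0 i) 0; first by exists 0%N; rewrite mulr0.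
  exists `|\adj M k j|%N; rewrite natr_absz.
  have xj : x 0 (f j) = y 0 j by rewrite mxE.
  rewrite intr_norm; apply: (mulfI (lt0r_neq0 l_gt0)).
  rewrite -[X in X * _ = _](gtr0_norm l_gt0) -normrM -yadj normrM -xj ger0_norm //.
  by rewrite mulrCA mulrA /t divfK ?gt_eqF // mulrC intr_norm.
exists c; first by exists t.
have -> : (\sum_i c i)%:R = `|\det M|%:~R :> F.
  rewrite natr_sum; under eq_bigr do rewrite cE.
  by rewrite -mulr_sumr -/l divfK // gt_eqF.
by apply: bndC => //; exists k.
Qed.

(** Induction on the support size. If the rows of [1 | A] on the support are independent, the
    preceding lemma applies. A dependency [w] among them lies in the kernel and has coordinate sum
    0, so moving [x] along it shrinks the support without changing the l1-norm. *)
Lemma exists_circuit (C : F) x :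
  bounds_minors C -> (forall i, 0 <= x 0 i) -> x != 0 -> x *m AF = 0 ->
  exists c, [/\ forall i, x 0 i = 0 -> c i = 0%N, exists i, (0 < c i)%N,
    (\row_i (c i)%:R : 'rV[F]_n) *m AF = 0 & (\sum_i c i)%:R <= C].
Proof.
move=> bndC; have [s] := ubnP #|[pred i | x 0 i != 0]|; elim: s x => // s IHs x.
rewrite ltnS => x_small x_ge0 x_neq0 xA.
pose f (j : 'I_#|[pred i | x 0 i != 0]|) := enum_val j.
have f_supp i : x 0 i != 0 -> exists j, i = f j.
  move=> xi; have xi' : i \in [pred i | x 0 i != 0] by rewrite inE.
  by exists (enum_rank_in xi' i); rewrite /f enum_rankK_in.
have [Bfree|] := boolP (row_free (rowsub f (map_mx intr A1 : 'M[F]_(n, 1 + r)))).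
  have [c [t t_gt0 cE] c_le] :=
    circuit_of_row_free bndC x_ge0 x_neq0 xA (@enum_val_inj _ _) f_supp Bfree.
  exists c; split=> // [i xi0||].
  - by apply/eqP; rewrite -(pnatr_eq0 F) cE xi0 mulr0.
  - have [i xi] : exists i, x 0 i != 0.
      apply/existsP; apply: contraNT x_neq0; rewrite negb_exists => /forallP x0.
      by apply/eqP/rowP => i; rewrite mxE; apply/eqP; have := x0 i; rewrite negbK.
    exists i; rewrite -(ltr_nat F) cE mulr_gt0 //.
    by rewrite lt_def xi x_ge0.
  have -> : \row_i (c i)%:R = t *: x by apply/rowP => i; rewrite !mxE cE.
  by rewrite -scalemxAl xA scaler0.
set B := rowsub f _; rewrite -kermx_eq0 => /rowV0Pn[v /sub_kermxP vB v_neq0].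
pose w : 'rV[F]_n := v *m rowsub f 1%:M.
have wA1 : w *m map_mx intr A1 = 0.
  by rewrite -mulmxA mul_rowsub_mx mul1mx vB.
have w_supp i : x 0 i = 0 -> w 0 i = 0.
  move=> xi; rewrite mxE big1 // => j _; rewrite !mxE.
  case: eqP => [ji|]; last by rewrite mulr0.
  by have := enum_valP j; rewrite inE -/(f j) ji xi eqxx.
have [w1 wA] : \sum_i w 0 i = 0 /\ w *m AF = 0.
  move: wA1; rewrite map_row_mx mul_mx_row -row_mx0 => /eq_row_mx[/rowP w1 ->].
  split=> //; have := w1 0; rewrite !mxE => {2}<-.
  by apply: eq_bigr => i _; rewrite !mxE mulr1.
have w_neq0 : w != 0.
  apply: contraNneq v_neq0 => w0; apply/eqP/rowP => j; rewrite [RHS]mxE.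
  have /rowP/(_ (f j)) := w0; rewrite !mxE (bigD1 j) //= !mxE eqxx mulr1.
  rewrite big1 ?addr0 // => i ij.
  by rewrite !mxE (inj_eq enum_val_inj) (negPf ij) mulr0.
have w_pos : exists i, 0 < w 0 i.
  apply/existsP; apply: contraNT w_neq0; rewrite negb_exists => /forallP w_le0.
  apply/eqP/rowP => i; rewrite [RHS]mxE; apply: oppr_inj; rewrite oppr0.
  apply: (psumr_eq0P (P := xpredT) (F := fun i => - w 0 i)) => // [j _|].
    by rewrite oppr_ge0 leNgt w_le0.
  by rewrite sumrN w1 oppr0.
have [t t_ge0 [x'_ge0 [i wi x'i]]] := max_nonneg_step x_ge0 w_pos.
set x' := x - t *: w in x'_ge0 x'i.
have x'_supp j : x 0 j = 0 -> x' 0 j = 0.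
  by move=> xj; rewrite 3!mxE xj w_supp // mulr0 subr0.
case: (IHs x') => // [|||c [c_supp c_pos cA c_le]].
- apply: leq_trans x_small; apply: proper_card; apply/properP; split.
    by apply/fintype.subsetP => j; rewrite !inE; apply: contra => /eqP/x'_supp->.
  exists i; rewrite inE ?x'i ?eqxx //.
  by apply: contraTneq wi => /w_supp->; rewrite ltxx.
- apply: contraNneq x_neq0 => x'0; apply/eqP/rowP => j; rewrite [RHS]mxE.
  apply: (psumr_eq0P (P := xpredT) (F := fun i => x 0 i)) => //.
  transitivity (\sum_i x' 0 i).
    under [RHS]eq_bigr do rewrite 3!mxE.
    by rewrite big_split /= sumrN -mulr_sumr w1 mulr0 subr0.
  by rewrite x'0 big1 // => k _; rewrite mxE.
- by rewrite mulmxBl xA -scalemxAl wA scaler0 subr0.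
by exists c; split=> // j /x'_supp/c_supp.
Qed.

(** Each circuit subtracted lowers the dimension of the space of kernel vectors supported on [x],
    which bounds the number of circuits. The induction runs over all kernel vectors [x] between 0
    and [c], since the remainders need not be integral. *)
Lemma minimal_kernel_bound (C : F) c :
  0 <= C -> bounds_minors C -> (\row_i (c i)%:R : 'rV[F]_n) *m AF = 0 ->
  (forall c', (\row_i (c' i)%:R : 'rV[F]_n) *m AF = 0 ->
    (forall i, (c' i <= c i)%N) -> (exists i, (0 < c' i)%N) ->
    forall i, c' i = c i) ->
  (\sum_i c i)%:R <= (n - \rank AF)%N%:R * C.
Proof.
move=> C_ge0 bndC cA c_min.
(* The row space of [D x] consists of the vectors supported on the support of [x]. *)
pose D x : 'M[F]_n := diag_mx (\row_i (x 0 i != 0)%:R).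
have subD x w : reflect (forall i, x 0 i = 0 -> w 0 i = 0) (w <= D x)%MS.
  apply: (iffP idP) => [/submxP[v ->] i xi | w_supp].
    by rewrite mul_mx_diag !mxE xi eqxx mulr0.
  apply/submxP; exists w; apply/rowP => i; rewrite mul_mx_diag !mxE.
  by have [/w_supp->|_] := eqVneq; rewrite ?mul0r ?mulr1.
pose V x := (kermx AF :&: D x)%MS.
suff bnd x : (forall i, 0 <= x 0 i <= (c i)%:R) -> x *m AF = 0 ->
    \sum_i x 0 i <= (\rank (V x))%:R * C.
  have /bnd : forall i, 0 <= (\row_i (c i)%:R : 'rV[F]_n) 0 i <= (c i)%:R.
    by move=> i; rewrite mxE ler0n lexx.
  have -> : (\sum_i c i)%:R = \sum_i (\row_i (c i)%:R : 'rV[F]_n) 0 i.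
    by rewrite natr_sum; apply: eq_bigr => i _; rewrite mxE.
  move=> /(_ cA)/le_trans; apply; rewrite ler_wpM2r // ler_nat.
  by rewrite -mxrank_ker mxrankS // capmxSl.
have [s] := ubnP (\rank (V x)); elim: s x => // s IHs x.
rewrite ltnS => x_small x_bnd xA.
have x_ge0 i : 0 <= x 0 i by case/andP: (x_bnd i).
have [->|x_neq0] := eqVneq x 0.
  by rewrite big1 ?mulr_ge0 // => i _; rewrite mxE.
have xV : (x <= V x)%MS by rewrite sub_capmx sub_kermx xA eqxx; apply/subD.
have [d [d_supp [i0 di0] dA d_le]] := exists_circuit bndC x_ge0 x_neq0 xA.
pose w : 'rV[F]_n := \row_i (d i)%:R.
have w_pos : exists i, 0 < w 0 i by exists i0; rewrite mxE ltr0n.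
have [t t_ge0 [x'_ge0 [i wi x'i]]] := max_nonneg_step x_ge0 w_pos.
set x' := x - t *: w in x'_ge0 x'i.
have w_le j : t * (d j)%:R <= x 0 j by have := x'_ge0 j; rewrite !mxE subr_ge0.
(* A coefficient [t >= 1] puts the integral circuit [d] below [c], so [d = c] by minimality and one
   circuit suffices. *)
have [t_ge1|/ltW t_le1] := leP 1 t.
  have dc : forall j, d j = c j.
    apply: c_min => // [j|]; last by exists i0.
    rewrite -(ler_nat F); case/andP: (x_bnd j) => _; apply: le_trans.
    by apply: le_trans (w_le j); rewrite ler_peMl.
  apply: le_trans (_ : (\sum_j d j)%:R <= _).
    by rewrite natr_sum; apply: ler_sum => j _; rewrite dc; case/andP: (x_bnd j).
  apply: le_trans d_le _; rewrite ler_peMl // ler1n lt0n mxrank_eq0.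
  by apply: contraNneq x_neq0 => V0; move: xV; rewrite V0 submx0.
have x'_supp j : x 0 j = 0 -> x' 0 j = 0.
  by move=> xj; rewrite !mxE xj d_supp // mulr0 subr0.
(* The vector [x] lies in [V x] but not in [V x']: at [i], [x'] vanishes while [d], hence [x], does
   not. *)
have V'V : (V x' < V x)%MS.
  rewrite ltmxE; apply/andP; split.
    apply: capmxS => //; apply/row_subP => j; apply/subD => k /x'_supp x'k.
    by apply/(subD x' _) => //; apply: row_sub.
  apply: contraTN wi => VV'; have := submx_trans xV VV'.
  rewrite sub_capmx => /andP[_ /subD/(_ i x'i)/d_supp di0'].
  by rewrite mxE di0' ltxx.
have x'A : x' *m AF = 0 by rewrite mulmxBl xA -scalemxAl dA scaler0 subr0.
have x'_bnd j : 0 <= x' 0 j <= (c j)%:R.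
  rewrite x'_ge0 /=; case/andP: (x_bnd j) => _; apply: le_trans.
  by rewrite !mxE gerBl mulr_ge0.
have x'_le := IHs _ (leq_trans (rank_ltmx V'V) x_small) x'_bnd x'A.
have -> : \sum_j x 0 j = \sum_j x' 0 j + t * (\sum_j d j)%:R.
  rewrite natr_sum mulr_sumr -big_split /=; apply: eq_bigr => j _.
  by rewrite !mxE subrK.
apply: le_trans (_ : (\rank (V x')).+1%:R * C <= _); last first.
  by rewrite ler_wpM2r // ler_nat rank_ltmx.
rewrite -natr1 mulrDl mul1r lerD //; apply: le_trans d_le.
by rewrite ler_piMl.
Qed.
End Circuits.

(** * Minimal zero-sum sequences *)

(** Lists replace multisets: a proper nonempty sub-multiset becomes one part of a splitting, up to
    permutation, into two nonempty lists. *)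
Definition min_zero_sum_seq (G : zmodType) (G0 : set G) (s : seq G) : Prop :=
  [/\ s != [::], forall g, g \in s -> G0 g, \sum_(g <- s) g = 0
    & forall t u, perm_eq s (t ++ u) -> t != [::] -> u != [::] ->
        \sum_(g <- t) g != 0].

Lemma minimal_zero_sum_enum (G : zmodType) (G0 : set G) (S : {mset G}%mset) :
  minimal_zero_sum G0 S -> min_zero_sum_seq G0 S.
Proof.
move=> [S0 SG Ssum Smin]; split=> //.
  by rewrite -size_eq0 size_mset_eq0; apply/eqP.
move=> t u Stu t0 u0.
have StuE a : S a = (count_mem a t + count_mem a u)%N.
  by rewrite -count_mem_mset -count_cat; apply/permP.
rewrite -(perm_big _ (perm_eq_seq_mset t)); apply/eqP/Smin.
  rewrite mproperE; apply/andP; split.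
    by apply/msubsetP => a; rewrite mset_seqE StuE leq_addr.
  case: u u0 StuE {Stu} => // a u _ /(_ a); rewrite /= eqxx => Sa.
  by apply/negP => /msubsetP/(_ a); rewrite Sa mset_seqE -[leqRHS]addn0 leq_add2l.
move=> tE; case: t t0 tE {Stu StuE} => // a t _ /msetP/(_ a).
by rewrite mset_seqE mset0E /= eqxx.
Qed.

Lemma minimal_zero_sum_seq_mset (G : zmodType) (G0 : set G) (s : seq G) :
  min_zero_sum_seq G0 s -> minimal_zero_sum G0 (seq_mset s).
Proof.
move=> [s0 sG ssum smin]; have ps := perm_eq_seq_mset s; split.
- by move=> sE; move: s0; rewrite -size_eq0 -(perm_size ps) sE size_mset0.
- by move=> g; rewrite (perm_mem ps); apply: sG.
- by rewrite (perm_big _ ps).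
move=> T /[dup] /mproper_sub Ts; rewrite mproperE => /andP[_ sT] T0.
apply/eqP; apply: (smin _ (seq_mset s `\` T)%mset).
- apply/allP => x _ /=; rewrite count_cat !count_mem_mset msetE2 mset_seqE.
  by rewrite subnKC // -mset_seqE; apply/msubsetP.
- by rewrite -size_eq0 size_mset_eq0; apply/eqP.
by rewrite -size_eq0 size_mset_eq0 msetB_eq0.
Qed.

(** * Sequences given by multiplicities over a finite family *)

Section Multiplicities.
Variables (G : zmodType) (n : nat) (g : 'I_n -> G).
Hypothesis g_inj : injective g.

Definition seq_of_mult (c : 'I_n -> nat) : seq G :=
  flatten [seq nseq (c i) (g i) | i <- enum 'I_n].

Lemma mem_seq_of_mult c x : x \in seq_of_mult c -> exists2 i, x = g i & (0 < c i)%N.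
Proof.
by case/flatten_mapP => i _; rewrite mem_nseq => /andP[ci /eqP->]; exists i.
Qed.

Lemma sum_seq_of_mult c : \sum_(x <- seq_of_mult c) x = \sum_i g i *+ c i.
Proof.
rewrite /seq_of_mult big_flatten big_map big_enum /=; apply: eq_bigr => i _.
by rewrite big_nseq; elim: (c i) => //= k ->; rewrite mulrS.
Qed.

Lemma size_seq_of_mult c : size (seq_of_mult c) = (\sum_i c i)%N.
Proof.
rewrite size_flatten /shape -map_comp sumnE big_map big_enum /=.
by apply: eq_bigr => i _; rewrite size_nseq.
Qed.

Lemma count_seq_of_mult c i : count_mem (g i) (seq_of_mult c) = c i.
Proof.
rewrite count_flatten -map_comp sumnE big_map big_enum /= (bigD1 i) //= count_nseq.
rewrite /= eqxx mul1n big1 ?addn0 // => j ji.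
by rewrite count_nseq /= (inj_eq g_inj) (negPf ji).
Qed.

Lemma perm_seq_of_mult s : (forall x, x \in s -> exists i, x = g i) ->
  perm_eq s (seq_of_mult (fun i => count_mem (g i) s)).
Proof.
move=> sg; apply/allP => x; rewrite mem_cat => /orP xs.
have [i ->] : exists i, x = g i.
  by case: xs => [/sg //|/mem_seq_of_mult[i -> _]]; exists i.
by rewrite /= count_seq_of_mult.
Qed.

Lemma perm_seq_of_multD c d :
  perm_eq (seq_of_mult (fun i => (c i + d i)%N)) (seq_of_mult c ++ seq_of_mult d).
Proof.
apply/allP => x; rewrite !mem_cat => xs.
have [i ->] : exists i, x = g i.
  by case/or3P: xs => /mem_seq_of_mult[i -> _]; exists i.
by rewrite /= count_cat !count_seq_of_mult.
Qed.

End Multiplicities.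

Lemma Zbasis_coordinates (G : zmodType) r (e : 'I_r -> G) : is_Zbasis e ->
  exists2 f : {additive G -> 'rV[int]_r}, injective f &
    forall c : 'I_r -> int, f (\sum_i e i *~ c i) = \row_i c i.
Proof.
move=> eB; pose cf x := projT1 (cid (eB x)).
have cfE x : x = \sum_i e i *~ cf x i by rewrite /cf; case: cid => c [].
have cfU x c : x = \sum_i e i *~ c i -> forall i, cf x i = c i.
  rewrite /cf; case: cid => d [/= _ dU] xE i; rewrite (dU [ffun i => c i]) ?ffunE //.
  by rewrite xE; apply: eq_bigr => j _; rewrite ffunE.
pose f x : 'rV[int]_r := \row_i cf x i.
have f_add : zmod_morphism f.
  move=> x y; apply/rowP => i; rewrite !mxE.
  apply: (cfU _ (fun i => cf x i - cf y i)).
  rewrite {1}(cfE x) {1}(cfE y) -sumrB; apply: eq_bigr => j _.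
  by rewrite mulrzBr.
pose fA := GRing.isZmodMorphism.Build _ _ f f_add.
exists (HB.pack f fA : {additive G -> 'rV[int]_r}) => [x y /rowP xy|c] /=.
  by rewrite (cfE x) (cfE y); apply: eq_bigr => i _; have := xy i; rewrite !mxE => ->.
by apply/rowP => i; rewrite !mxE; apply: cfU.
Qed.

(** Through [f], multiplicity vectors of zero-sum sequences over [g] become nonnegative integral
    kernel vectors of [A]; a smaller nonzero one would cut off a zero-sum part of [s]. *)
Lemma min_zero_sum_size_bound (F : realFieldType) (G : zmodType) (G0 : set G) r
    (f : {additive G -> 'rV[int]_r}) n (g : 'I_n -> G) (A : 'M[int]_(n, r))
    (C : F) (s : seq G) :
  injective f -> injective g ->
  (forall i j, A i j = f (g i) 0 j) -> 0 <= C -> bounds_minors A C ->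
  min_zero_sum_seq G0 s -> (forall x, x \in s -> exists i, x = g i) ->
  (size s)%:R <= (n - \rank (map_mx intr A : 'M[F]_(n, r)))%N%:R * C.
Proof.
move=> f_inj g_inj AE C_ge0 bndC [s0 sG ssum smin] sg.
pose c i := count_mem (g i) s; have sE := perm_seq_of_mult g_inj sg.
rewrite (perm_size sE) size_seq_of_mult.
have kerE d : (\row_i (d i)%:R : 'rV[F]_n) *m
    map_mx intr A = map_mx intr (f (\sum_i g i *+ d i)).
  apply/rowP => j; rewrite !mxE raddf_sum summxE rmorph_sum /=.
  by apply: eq_bigr => i _; rewrite !mxE AE raddfMn mulmxnE rmorphMn mulr_natl.
have kerP d : (\row_i (d i)%:R : 'rV[F]_n) *m
    map_mx intr A = 0 <-> \sum_i g i *+ d i = 0.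
  rewrite kerE; split=> [fd0|->]; last first.
    by rewrite raddf0; apply/rowP => j; rewrite !mxE.
  apply: f_inj; rewrite raddf0; apply/rowP => j.
  by have /rowP/(_ j) := fd0; rewrite !mxE => /eqP; rewrite intr_eq0 => /eqP.
apply: minimal_kernel_bound => //.
  by apply/kerP; rewrite -sum_seq_of_mult -(perm_big _ sE).
move=> d /kerP d0 dc [i0 di0] i; apply/eqP; rewrite eqn_leq dc /=.
have sdE : perm_eq s (seq_of_mult g d ++ seq_of_mult g (fun i => c i - d i)%N).
  apply: (perm_trans sE); apply: perm_trans (perm_seq_of_multD g_inj _ _).
  suff <- : seq_of_mult g c = seq_of_mult g (fun i => d i + (c i - d i))%N by [].
  by congr flatten; apply: eq_map => k; rewrite subnKC.
rewrite leqNgt; apply/negP => ci.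
have mult_neq0 k d' : (0 < d' k)%N -> seq_of_mult g d' != [::].
  by apply: contraTneq => dE; rewrite -(count_seq_of_mult g_inj d' k) dE.
have := smin _ _ sdE (mult_neq0 i0 _ di0) (mult_neq0 i _ _).
by rewrite sum_seq_of_mult d0 eqxx subn_gt0 => /(_ ci).
Qed.

(** * Determinants of 0/1 matrices up to sign, and finiteness of the Davenport constant *)

(* Scaling the 0/1 columns by 2 and bordering by one row and column turns the
   matrix into one with entries in {0, 1, -1}, to which Hadamard applies. *)
Lemma det_sign_01_bound (F : realFieldType) m (M : 'M[F]_m) (k : 'I_m)
    (sg : 'I_m -> bool) (b : 'I_m -> 'I_m -> bool) :
  (forall i, M i k = 1) ->
  (forall i j, j != k -> M i j = (-1) ^+ sg i * (b i j)%:R) ->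
  \det M ^+ 2 * (4 ^ m.-1)%N%:R <= (m.+1 ^ m.+1)%N%:R.
Proof.
move=> Mk Mb.
pose dl : 'rV[F]_m := \row_i (-1) ^+ sg i.
pose dr : 'rV[F]_m := \row_j (if j == k then 1 else 2).
pose T := diag_mx dl *m M *m diag_mx dr.
have TE i j : T i j = if j == k then (-1) ^+ sg i else 2 * (b i j)%:R.
  rewrite /T mul_mx_diag mxE mul_diag_mx !mxE; have [->|jk] := eqVneq.
    by rewrite Mk !mulr1.
  by rewrite Mb // mulrA -signr_addb addbb mul1r mulrC.
have detT : \det T ^+ 2 = \det M ^+ 2 * (4 ^ m.-1)%N%:R.
  rewrite !det_mulmx !det_diag !exprMn.
  have -> : (\prod_i dl 0 i) ^+ 2 = 1.
    by rewrite -prodrXl big1 // => i _; rewrite mxE sqrr_sign.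
  have -> : (\prod_i dr 0 i) ^+ 2 = (4 ^ m.-1)%N%:R; last by rewrite mul1r.
  rewrite -prodrXl (bigD1 k) //= !mxE eqxx expr1n mul1r natrX.
  under eq_bigr => i ik do rewrite mxE (negPf ik).
  rewrite prodr_const cardC1 card_ord; congr (_ ^+ _); ring.
rewrite -detT.
(* Subtracting the border row turns the entries 0 and 2 into -1 and 1; it has 0 at [k], where the
   entries of [T] are already signs. *)
pose u : 'rV[F]_m := \row_j (j != k)%:R.
pose E : 'M[F]_(1 + m) := block_mx 1%:M 0 (const_mx (-1)) 1%:M.
pose N : 'M[F]_(1 + m) := block_mx 1%:M u 0 T.
have detEN : \det (E *m N) = \det T.
  by rewrite det_mulmx det_lblock det_ublock !det1 !mul1r.
rewrite -detEN; apply: det_unit_entries_bound => i j.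
rewrite mulmx_block !mul1mx !mul0mx !mulmx1 !addr0.
case: (split_ordP i) => {}i ->; case: (split_ordP j) => {}j ->.
- by rewrite block_mxEul ord1 mxE ord1 eqxx normr1.
- by rewrite block_mxEur mxE; case: eqP => _; rewrite ?normr0 ?normr1.
- by rewrite block_mxEdl mxE normrN1.
rewrite block_mxEdr [_ i j]mxE TE !mxE big_ord1 !mxE.
have [_|_] := eqVneq; first by rewrite mulr0 add0r normr_sign.
case: (b i j); rewrite ?mulr0 ?mulr1 ?addr0 ?normrN1 //.
by rewrite (_ : -1 + 2 = 1) ?normr1 //; ring.
Qed.

(** The first two terms of the binomial expansion of $(m+2)^{m+1}$ both equal $(m+1)^{m+1}$. Hence
    the bound $(m+1)^{m+1}/4^{m-1}$ for squared minors of order $m$ grows with $m$. *)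
Lemma expnn_ratio_mono m : (4 * m.+1 ^ m.+1 <= m.+2 ^ m.+2)%N.
Proof.
have H : (m.+1 ^ m.+1 + m.+1 * m.+1 ^ m <= m.+2 ^ m.+1)%N.
  rewrite -[m.+2]addn1 expnDn big_ord_recl bin0 subn0 exp1n !mul1n muln1 leq_add2l.
  rewrite big_ord_recl /= bin1 exp1n muln1 subSS subn0; exact: leq_addr.
rewrite [(m.+2 ^ m.+2)%N]expnS; rewrite -expnS in H.
apply: leq_trans (leq_mul (leqnn m.+2) H); rewrite addnn -mul2n mulnA leq_mul2r.
by apply/orP; right; lia.
Qed.

Lemma expnn_ratio_le m r : (0 < m <= r.+1)%N ->
  (m.+1 ^ m.+1 * 4 ^ (r.+1 - m) <= r.+2 ^ r.+2)%N.
Proof.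
case/andP=> m0; elim: r => [|r IHr]; first by case: m m0 => [|[|]].
rewrite leq_eqVlt => /orP[/eqP->|]; first by rewrite subnn muln1.
rewrite ltnS => mr; rewrite subSn // [(4 ^ _)%N]expnS mulnCA.
exact: leq_trans (leq_mul (leqnn 4) (IHr mr)) (expnn_ratio_mono _).
Qed.

(** A finite set gives one matrix with finitely many minors, whose maximum serves as [C]; duplicates
    are removed so that the enumeration [g] is injective. *)
Lemma finite_min_zero_sum_bounded (G : zmodType) r (e : 'I_r -> G) (G0 : set G) :
  is_Zbasis e -> finite_set G0 ->
  exists N, forall s, min_zero_sum_seq G0 s -> (size s <= N)%N.
Proof.
move=> /Zbasis_coordinates[f f_inj _] /finite_seqP[sG ->].
pose g (i : 'I_(size (undup sG))) := tnth (in_tuple (undup sG)) i.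
have g_inj : injective g by apply/tuple_uniqP; apply: undup_uniq.
set n := size (undup sG) in g g_inj *.
pose A : 'M[int]_(n, r) := \matrix_(i, j) f (g i) 0 j.
pose C := (\max_(m < n.+1) \max_(a : {ffun 'I_m -> 'I_n})
  \max_(b : {ffun 'I_m -> 'I_(1 + r)})
  `|(\det (mxsub a b (row_mx (const_mx 1) A)))%R|)%N.
have bndC : bounds_minors A (C%:R : rat).
  move=> m a b a_inj _ _; rewrite -natr_absz ler_nat.
  have mn : (m < n.+1)%N.
    by rewrite ltnS -[m]card_ord -[n]card_ord; apply: leq_card a_inj.
  apply: leq_trans (leq_bigmax (Ordinal mn)).
  apply: leq_trans (leq_bigmax [ffun i => a i]).
  apply: leq_trans (leq_bigmax [ffun i => b i]).
  rewrite [X in (_ <= `|(\det X)%R|)%N](_ : _ = mxsub a b (row_mx (const_mx 1) A)) //.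
  by apply/matrixP => i j; rewrite [LHS]mxE [RHS]mxE !ffunE.
exists ((n - \rank (map_mx intr A : 'M[rat]_(n, r))) * C)%N => s s_min.
rewrite -(ler_nat rat) natrM.
apply: (min_zero_sum_size_bound f_inj g_inj _ _ bndC s_min) => // [i j|x xs].
  by rewrite mxE.
case: s_min => _ /(_ x xs) /= xG _ _.
have : x \in in_tuple (undup sG) by rewrite mem_undup.
by case/tnthP => i ->; exists i.
Qed.

(** * Elements of $\pm G_r^+$ in coordinates *)

Section SignedSums.
Variables (G : zmodType) (r : nat) (e : 'I_r -> G).

Definition signed_sum (sg : bool) (eps : 'I_r -> bool) : G :=
  if sg then - (\sum_i e i *+ eps i) else \sum_i e i *+ eps i.

Lemma signed_sum_mem sg (eps : 'I_r -> bool) : (exists i, eps i) ->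
  (pos_sums e `|` oppset (pos_sums e)) (signed_sum sg eps).
Proof.
move=> eps_i; have P : pos_sums e (\sum_i e i *+ eps i) by exists eps.
by case: sg; [right; exists (\sum_i e i *+ eps i)|left].
Qed.

Lemma mem_signed_sum x : (pos_sums e `|` oppset (pos_sums e)) x ->
  exists sg (eps : 'I_r -> bool), (exists i, eps i) /\ x = signed_sum sg eps.
Proof.
by case=> [[eps [eps_i ->]]|[_ [eps [eps_i ->]] <-]];
  [exists false, eps|exists true, eps].
Qed.

Variable f : {additive G -> 'rV[int]_r}.
Hypothesis fE : forall c : 'I_r -> int, f (\sum_i e i *~ c i) = \row_i c i.

Lemma signed_sum_coord sg (eps : 'I_r -> bool) i :
  f (signed_sum sg eps) 0 i = (-1) ^+ sg * (eps i)%:R.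
Proof.
have fP : f (\sum_i e i *+ eps i) 0 i = (eps i)%:R.
  have /rowP/(_ i) := fE (fun i => (eps i : nat)%:Z).
  by rewrite [RHS]mxE natz.
rewrite /signed_sum; case: sg; rewrite ?raddfN ?mxE fP.
  by rewrite mulN1r.
by rewrite mul1r.
Qed.

End SignedSums.

(** * The Fibonacci lower bound *)

(* Coordinate k >= 1 of the zero-sum relation with multiplicities m_0, .., m_r says
   m_k = m_(k-1) + m_(k-3) + ...; alternating signs keep all the elements in
   +-G_r^+.  The solutions are the multiples of m_0 = 1, m_k = F_k. *)
Definition fib_mult (k : nat) : nat := if k is 0 then 1%N else fib k.

Definition fib_supp (j k : nat) : bool := (j == k) || (j < k)%N && odd (k - j).

Lemma sum_odd_gap_rec (d : nat -> nat) k :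
  (\sum_(j < k.+2 | odd (k.+2 - j)) d j =
   \sum_(j < k | odd (k - j)) d j + d k.+1)%N.
Proof.
rewrite big_mkcond !big_ord_recr /= subSnn subSn // subSnn addn0 [in RHS]big_mkcond.
congr (_ + _)%N; apply: eq_bigr => j _; have jk := ltnW (ltn_ord j).
by rewrite !subSn /= ?negbK // leqW.
Qed.

Lemma fib_multE k : (0 < k)%N ->
  fib_mult k = (\sum_(j < k | odd (k - j)) fib_mult j)%N.
Proof.
have [s] := ubnP k; elim: s k => // s IHs [|[|[|k]]] // ks _.
- by rewrite big_mkcond big_ord_recl big_ord0.
- by rewrite big_mkcond !big_ord_recl big_ord0.
by rewrite sum_odd_gap_rec -IHs //; [rewrite addnC|lia].
Qed.

Lemma sum_fib_mult r : (\sum_(j < r.+1) fib_mult j)%N = fib (r + 2).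
Proof.
elim: r => [|r IHr]; first by rewrite big_ord1.
by rewrite big_ord_recr /= IHr !addn2 addnC.
Qed.

Section FibonacciSequence.
Variables (G : zmodType) (r : nat) (e : 'I_r -> G).
Variable f : {additive G -> 'rV[int]_r}.
Hypothesis f_inj : injective f.
Hypothesis fE : forall c : 'I_r -> int, f (\sum_i e i *~ c i) = \row_i c i.

(** The sign $(-1)^j$ makes coordinate $k$ of element $k$ opposite to that of every element $j<k$
    with $k-j$ odd. Coordinates are numbered from 0 and relations from 1, hence [i.+1]. *)
Definition fib_elt (j : 'I_r.+1) : G :=
  signed_sum e (odd j) (fun i => fib_supp j i.+1).

(** For different parities, the coordinate of the odd index is -1 in one element and nonnegative in
    the other. For equal parities, the coordinate of the larger index vanishes only in the element
    of smaller index. *)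
Lemma fib_elt_inj : injective fib_elt.
Proof.
have parity (j j' : 'I_r.+1) : odd j -> ~~ odd j' -> fib_elt j <> fib_elt j'.
  move=> oj oj' /(congr1 f)/rowP eqf.
  have j_gt0 : (0 < j)%N by case: j oj {eqf} => [[|]].
  have jr : (j.-1 < r)%N by have := ltn_ord j; lia.
  have := eqf (Ordinal jr); rewrite !(signed_sum_coord fE) oj (negPf oj') /=.
  by rewrite prednK // {1}/fib_supp eqxx; case: fib_supp.
have small (j j' : 'I_r.+1) : odd j = odd j' -> (j < j')%N -> fib_elt j <> fib_elt j'.
  move=> oj jj' /(congr1 f)/rowP eqf.
  have jr : (j'.-1 < r)%N by have := ltn_ord j'; lia.
  have := eqf (Ordinal jr); rewrite !(signed_sum_coord fE) oj /=.
  rewrite prednK ?(leq_ltn_trans _ jj') // /fib_supp eqxx jj' ltn_eqF //=.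
  by rewrite oddB ?(ltnW jj') // oj addbb; case: odd.
move=> j j' eqj; apply/val_inj/eqP; apply: contraT => /=; rewrite neq_ltn.
have [oj|oj] := eqVneq (odd j) (odd j').
  by case/orP=> [/small|/small]; [move/(_ oj)|move/(_ (esym oj))]; rewrite eqj.
case: (boolP (odd j)) (boolP (odd j')) oj => [oj|oj] [oj'|oj']; rewrite ?oj ?oj' //.
  by have := parity _ _ oj oj'.
by have := parity _ _ oj' oj; rewrite eqj.
Qed.

Lemma sum_fib_elt_eq0 (d : nat -> nat) :
  (\sum_(j < r.+1) fib_elt j *+ d j = 0) <->
  (forall k, (0 < k <= r)%N -> d k = (\sum_(j < k | odd (k - j)) d j)%N).
Proof.
have coord (i : 'I_r) : f (\sum_(j < r.+1) fib_elt j *+ d j) 0 i =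
    (-1) ^+ odd i.+1 * ((d i.+1)%:R - (\sum_(j < i.+1 | odd (i.+1 - j)) d j)%:R).
  rewrite raddf_sum summxE (bigD1 (lift ord0 i)) //= mulrBr; congr (_ + _).
    rewrite raddfMn mulmxnE (signed_sum_coord fE) /= /fib_supp /bump /= add1n eqxx.
    by rewrite mulr1 mulr_natr.
  have ir : (i.+1 <= r.+1)%N by rewrite ltnW // ltnS.
  rewrite (big_ord_widen_cond _ (fun j => odd (i.+1 - j)) d ir) natr_sum.
  rewrite mulr_sumr -sumrN [RHS]big_mkcond [LHS]big_mkcond /=.
  apply: eq_bigr => j _; rewrite raddfMn mulmxnE (signed_sum_coord fE) /fib_supp.
  rewrite -(inj_eq val_inj) /= /bump /= add1n.
  case: eqVneq => [->|ji] /=; first by rewrite ltnn andbF.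
  case: ltnP => /= ji'; last by rewrite andbF mulr0 mul0rn.
  rewrite andbT oddB 1?ltnW // ; case: ifP => oj; last by rewrite mulr0 mul0rn.
  rewrite mulr1 -mulNr mulr_natr; congr (_ *+ _); move: oj => /=.
  by case: (odd i); case: (odd j).
split=> [d0 k /andP[k0 kr]|dk].
  have kr' : (k.-1 < r)%N by rewrite prednK.
  have /eqP := coord (Ordinal kr'); rewrite d0 raddf0 mxE eq_sym mulf_eq0 signr_eq0.
  by rewrite /= prednK // subr_eq0 => /eqP/eqP; rewrite eqr_nat => /eqP.
apply: f_inj; rewrite raddf0; apply/rowP => i.
by rewrite coord mxE -dk ?subrr ?mulr0 //=.
Qed.

Lemma sum_fib_elt_eq0_mult (d : nat -> nat) :
  \sum_(j < r.+1) fib_elt j *+ d j = 0 ->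
  forall k, (k <= r)%N -> d k = (d 0%N * fib_mult k)%N.
Proof.
move=> /sum_fib_elt_eq0 dk k; have [s] := ubnP k; elim: s k => // s IHs [|k] ks kr.
  by rewrite muln1.
rewrite dk // fib_multE // big_distrr /=; apply: eq_bigr => j _.
by have jk := ltn_ord j; rewrite IHs //; lia.
Qed.

(** In a splitting into two zero-sum parts, the single occurrence of element 0 misses one part. All
    multiplicities in that part are multiples of 0, so it is empty. *)
Lemma fib_min_zero_sum : (0 < r)%N -> exists2 s : seq G,
  min_zero_sum_seq (pos_sums e `|` oppset (pos_sums e)) s & size s = fib (r + 2).
Proof.
move=> r0; exists (seq_of_mult fib_elt fib_mult); last first.
  by rewrite size_seq_of_mult sum_fib_mult.
have count0 := count_seq_of_mult fib_elt_inj fib_mult ord0.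
split.
- by apply: contra_eqN count0 => /eqP->.
- move=> x /mem_seq_of_mult[j -> _]; apply: signed_sum_mem.
  have jr : (j.-1 < r)%N by have := ltn_ord j; lia.
  exists (Ordinal jr); rewrite /fib_supp /=.
  by case: (j : nat) => [|k] //=; rewrite eqxx.
- rewrite sum_seq_of_mult; apply/sum_fib_elt_eq0 => k /andP[k0 _].
  exact: fib_multE.
move=> t u stu t0 u0; apply/eqP => t_sum.
have tu_sum : \sum_(x <- u) x = 0.
  have := sum_seq_of_mult fib_elt fib_mult.
  rewrite (perm_big _ stu) big_cat /= t_sum add0r.
  by move=> ->; apply/sum_fib_elt_eq0 => k /andP[k0 _]; apply: fib_multE.
have sub_nil v : (forall x, x \in v -> x \in seq_of_mult fib_elt fib_mult) ->
    \sum_(x <- v) x = 0 -> count_mem (fib_elt ord0) v = 0%N -> v = [::].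
  move=> vs v_sum v0.
  have /(perm_seq_of_mult fib_elt_inj) vE :
      forall x, x \in v -> exists j, x = fib_elt j.
    by move=> x /vs/mem_seq_of_mult[j -> _]; exists j.
  pose d k := count_mem (fib_elt (inord k)) v.
  have dE (j : 'I_r.+1) : d j = count_mem (fib_elt j) v by rewrite /d inord_val.
  have /sum_fib_elt_eq0_mult d0 : \sum_(j < r.+1) fib_elt j *+ d j = 0.
    rewrite -[RHS]v_sum [RHS](perm_big _ vE) sum_seq_of_mult.
    by apply: eq_bigr => j _; rewrite dE.
  apply/size0nil; rewrite (perm_size vE) size_seq_of_mult big1 // => j _.
  rewrite -dE d0; last by rewrite -ltnS.
  by rewrite (dE ord0) v0.
have := permP stu (pred1 (fib_elt ord0)); rewrite count0 count_cat /=.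
have tS x : x \in t -> x \in seq_of_mult fib_elt fib_mult.
  by rewrite (perm_mem stu) mem_cat => ->.
have uS x : x \in u -> x \in seq_of_mult fib_elt fib_mult.
  by rewrite (perm_mem stu) mem_cat orbC => ->.
case: (count_mem _ t) (sub_nil t tS t_sum) => [/(_ erefl) tE|].
  by rewrite tE in t0.
case: (count_mem _ u) (sub_nil u uS tu_sum) => [/(_ erefl) uE|m _ l _ /=]; last by lia.
by rewrite uE in u0.
Qed.

End FibonacciSequence.

(** * Upper bound for the Davenport constant of $\pm G_r^+$ *)

Lemma min_zero_sum_opp_pair (G : zmodType) (G0 : set G) (s : seq G) x :
  min_zero_sum_seq G0 s -> x \in s -> - x \in s -> x != - x -> size s = 2%N.
Proof.
move=> [_ _ _ smin] xs nxs xnx.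
have nxs' : - x \in rem x s.
  by have := perm_mem (perm_to_rem xs) (- x); rewrite nxs inE eq_sym (negPf xnx).
have sE : perm_eq s ([:: x; - x] ++ rem (- x) (rem x s)).
  by apply: (perm_trans (perm_to_rem xs)); rewrite perm_cons perm_to_rem.
have := smin _ _ sE isT; rewrite big_cons big_seq1 subrr eqxx.
by move: (perm_size sE); case: (rem _ _) => [->|? ? _ /(_ isT)].
Qed.

Lemma powR_half_sqr (R : realType) (m : nat) :
  ((m%:R : R) `^ (m%:R / 2)) ^+ 2 = (m ^ m)%N%:R.
Proof.
by rewrite -powR_mulrn ?powR_ge0 // -powRrM divfK ?powR_mulrn ?ler0n ?natrX.
Qed.

(** Unless [s] contains some [x] and [- x], one sign can be fixed for each of the $2^r-1$ nonzero
    0/1 vectors. The resulting matrix has rank $r$, which gives the factor $2^r-r-1$, and its minors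
    through the column of ones are at most [B / 2 ^+ r]. *)
Lemma signed_min_zero_sum_bound (R : realType) (G : zmodType) r (e : 'I_r -> G)
    (s : seq G) :
  (2 <= r)%N -> is_Zbasis e ->
  min_zero_sum_seq (pos_sums e `|` oppset (pos_sums e)) s ->
  (size s)%:R <= (2 ^+ r - r%:R - 1) / 2 ^+ r * (r + 2)%:R `^ ((r + 2)%:R / 2) :> R.
Proof.
move=> r2 /Zbasis_coordinates[f f_inj fE] s_min.
set B := _ `^ _.
have B_ge0 : 0 <= B by apply: powR_ge0.
have B_sqr : B ^+ 2 = (r.+2 ^ r.+2)%N%:R by rewrite /B powR_half_sqr addn2.
have r_le : (r + 1 <= 2 ^ r)%N by rewrite addn1 ltn_expl.
have coefE : (2 ^+ r - r%:R - 1) / 2 ^+ r * B = (2 ^ r - r - 1)%N%:R * (B / 2 ^+ r).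
  rewrite -subnDA natrB // natrD natrX mulrAC -mulrA; congr (_ * _).
  by rewrite opprD addrA.
rewrite coefE.
have [[x [xs nxs]]|no_pair] := pselect (exists x, x \in s /\ - x \in s).
  rewrite (min_zero_sum_opp_pair s_min xs nxs) => [|]; last first.
    case: s_min => _ /(_ _ xs)/mem_signed_sum[sg [eps [[i epsi] xE]]] _ _.
    apply/eqP => /(congr1 f)/rowP/(_ i); rewrite raddfN mxE => /eqP.
    by rewrite eq_sym eqNr xE (signed_sum_coord fE) epsi mulr1 signr_eq0.
  (* Here the length is 2, while the coefficient is at least 1/4 and [B] at least 8. *)
  have r_big : (2 * 2 ^ r <= (2 ^ r - r - 1) * 8)%N.
    have : (4 * r.+1 <= 3 * 2 ^ r)%N; last by lia.
    by elim: (r) r2 => // [[|[|q]]] // IHq _; have := IHq isT; rewrite !expnS; lia.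
  have B_ge8 : 8 <= B.
    rewrite -ler_sqr ?nnegrE // B_sqr -natrX ler_nat.
    apply: (@leq_trans (4 ^ r.+2)%N); last by rewrite leq_exp2r.
    by apply: (@leq_trans (4 ^ 4)%N); last by rewrite leq_pexp2l.
  rewrite mulrA ler_pdivlMr ?exprn_gt0 // -natrX -natrM.
  apply: (@le_trans _ _ ((2 ^ r - r - 1) * 8)%N%:R); first by rewrite ler_nat.
  by rewrite natrM ler_wpM2l.
pose n := #|[pred E : {ffun 'I_r -> bool} | E != [ffun=> false]]|.
pose E (i : 'I_n) : {ffun 'I_r -> bool} := enum_val i.
(* Vectors occurring in [s] with neither sign get the positive one by default. *)
pose sg i := - signed_sum e false (E i) \in s.
pose g i := signed_sum e (sg i) (E i).
have E_surj eps : eps != [ffun=> false] -> exists i, E i = eps.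
  move=> eps0; have epsP : eps \in [pred E : {ffun 'I_r -> bool} | E != [ffun=> false]].
    by rewrite inE.
  by exists (enum_rank_in epsP eps); rewrite /E enum_rankK_in.
have E_neq0 i : exists j, E i j.
  have Ei : E i != [ffun=> false] by have := enum_valP i.
  apply/existsP; apply: contraNT Ei; rewrite negb_exists => /forallP Ei0.
  by apply/eqP/ffunP => j; rewrite ffunE; apply/negbTE.
have g_coord i j : f (g i) 0 j = (-1) ^+ sg i * (E i j)%:R by apply: signed_sum_coord.
have g_inj : injective g.
  move=> i i' /(congr1 f)/rowP eqg; apply: enum_val_inj; apply/ffunP => j.
  have := eqg j; rewrite !g_coord -/(E i) -/(E i').
  by case: (E i j); case: (E i' j) => //; case: (sg i); case: (sg i').
have [A AfE] : exists A : 'M[int]_(n, r), forall i j, A i j = f (g i) 0 j.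
  by exists (\matrix_(i, j) f (g i) 0 j) => i j; rewrite mxE.
have AE i j : A i j = (-1) ^+ sg i * (E i j)%:R by rewrite AfE g_coord.
have nE : n = (2 ^ r - 1)%N.
  by rewrite /n cardC1 card_ffun card_bool card_ord subn1.
have rankA : (r <= \rank (map_mx intr A : 'M[R]_(n, r)))%N.
  rewrite -[leqLHS](mxrank1 R) mxrankS //; apply/row_subP => j.
  have [i Ei] : exists i, E i = [ffun k => k == j].
    apply: E_surj; apply/eqP => /ffunP/(_ j).
    by rewrite !ffunE eqxx.
  have -> : row j 1%:M = (-1) ^+ sg i *: row i (map_mx intr A : 'M[R]_(n, r)).
    apply/rowP => k; rewrite !mxE AE Ei ffunE [k == j]eq_sym.
    by case: (j == k); case: (sg i);
      rewrite /= ?mulr0 // ?mulr1 ?mulrN1 ?mulN1r ?mul1r ?opprK.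
  by rewrite scalemx_sub // row_sub.
have bndC : bounds_minors A (B / 2 ^+ r).
  move=> m a b a_inj b_inj [k bk].
  set M := mxsub _ _ _; pose MF : 'M[R]_m := map_mx intr M.
  have m_le : (m <= r.+1)%N.
    by rewrite -[m]card_ord -[r.+1]card_ord; apply: leq_card b_inj.
  have m_gt0 : (0 < m)%N by apply: leq_trans (ltn_ord k).
  have MFk i : MF i k = 1.
    by rewrite !mxE bk; case: splitP => // j _; rewrite mxE.
  (* Injectivity of [b] keeps the column of ones from being selected twice, so the [false] branch is
     reached only at [k]. *)
  pose c i j := if fintype.split (b j) is inr l then E (a i) l else false.
  have MFE i j : j != k -> MF i j = (-1) ^+ (sg \o a) i * (c i j)%:R.
    rewrite !mxE /c => jk; case: splitP => l bj.
      by case/eqP: jk; apply: b_inj; rewrite bk; apply: val_inj; rewrite /= bj ord1.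
    by rewrite AE rmorphM rmorph_sign rmorph_nat.
  have := det_sign_01_bound MFk MFE.
  rewrite det_map_mx => detM.
  rewrite ler_pdivlMr ?exprn_gt0 // -ler_sqr ?nnegrE ?mulr_ge0 ?exprn_ge0 ?ler0z //.
  rewrite B_sqr.
  (* The factor $4^{r+1-m}$ completes $4^{m-1}$ to $4^r$, the square of the denominator [2 ^+ r]. *)
  apply: le_trans (_ : (m.+1 ^ m.+1 * 4 ^ (r.+1 - m))%N%:R <= _); last first.
    by rewrite ler_nat expnn_ratio_le // m_gt0.
  rewrite natrM; apply: le_trans (ler_wpM2r _ detM) => //.
  rewrite -mulrA -natrM -expnD exprMn intr_norm real_normK ?num_real //.
  rewrite ler_wpM2l ?sqr_ge0 // -exprM mulnC exprM natrX.
  by rewrite (_ : m.-1 + (r.+1 - m) = r)%N -?[2 ^+ 2]natrX //; lia.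
have sg_supp x : x \in s -> exists i, x = g i.
  move=> xs; have [_ /(_ x xs)/mem_signed_sum[b [eps [[j0 epsj0] xE]]] _ _] := s_min.
  have [|i Ei] := E_surj [ffun j => eps j].
    by apply/eqP => /ffunP/(_ j0); rewrite !ffunE epsj0.
  have signE b' : signed_sum e b' (E i) = signed_sum e b' eps.
    by rewrite /signed_sum Ei; under eq_bigr do rewrite ffunE.
  exists i; rewrite /g signE xE; congr signed_sum; rewrite /sg signE.
  case: b xE => xE; first by rewrite -[- _]/(signed_sum e true eps) -xE xs.
  by apply/esym/negbTE/negP => nxs; case: no_pair; exists x; rewrite -xE in nxs.
have C_ge0 : 0 <= B / 2 ^+ r by rewrite divr_ge0 // exprn_ge0.
have := min_zero_sum_size_bound f_inj g_inj AfE C_ge0 bndC s_min sg_supp.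
move=> /le_trans; apply; rewrite ler_wpM2r // ler_nat.
by apply: leq_trans (leq_sub2l _ rankA) _; rewrite nE subnAC.
Qed.

(** * Sets of lengths and zero-sum sequences *)

Lemma perm_map_lift (S : choiceType) (T : eqType) (h : S -> T) s w :
  perm_eq (map h s) w -> exists2 s', perm_eq s s' & map h s' = w.
Proof.
elim: w s => [|x w IHw] s.
  by move=> /perm_size; case: s => // _; exists [::].
move=> sw; have : x \in map h s by rewrite (perm_mem sw) mem_head.
case/mapP => a a_s xE; have := sw; rewrite (permPl (perm_map h (perm_to_rem a_s))) /=.
rewrite xE perm_cons => /IHw[s' ss' <-]; exists (a :: s') => //.
by apply: perm_trans (perm_to_rem a_s) _; rewrite perm_cons.
Qed.

Lemma perm_map_cat_lift (S : choiceType) (T : eqType) (h : S -> T) s t u :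
  perm_eq (map h s) (t ++ u) ->
  exists s1 s2, [/\ perm_eq s (s1 ++ s2), map h s1 = t & map h s2 = u].
Proof.
move=> /perm_map_lift[s' ss' s'E].
exists (take (size t) s'), (drop (size t) s').
by rewrite cat_take_drop map_take map_drop s'E take_size_cat ?drop_size_cat.
Qed.

Lemma min_zero_sum_perm (G : zmodType) (G0 : set G) s t :
  perm_eq s t -> min_zero_sum_seq G0 s -> min_zero_sum_seq G0 t.
Proof.
move=> st [s0 sG ssum smin]; split.
- by rewrite -size_eq0 -(perm_size st) size_eq0.
- by move=> g; rewrite -(perm_mem st); apply: sG.
- by rewrite -(perm_big _ st).
by move=> u v tuv; apply: smin; apply: perm_trans tuv.
Qed.

(* Counting 0 twice gives the sequence [:: 0] the weight of a pair, so that prime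
   elements of class 0 need no separate treatment in length bounds. *)
Lemma min_zero_sum_weight (G : zmodType) (G0 : set G) s N :
  (2 <= N)%N -> (forall s, min_zero_sum_seq G0 s -> (size s <= N)%N) ->
  min_zero_sum_seq G0 s -> (2 <= size s + count_mem 0%R s <= N)%N.
Proof.
move=> N2 bnd s_min; have sN := bnd _ s_min; case: s_min => s0 _ ssum smin.
have [s_0|s_n0] := boolP (0 \in s); last first.
  rewrite (count_memPn s_n0) addn0 sN andbT.
  case: s s0 ssum s_n0 {sN smin} => [|x [|]] //= _.
  by rewrite big_seq1 => ->; rewrite mem_head.
have sE : perm_eq s ([:: 0] ++ rem 0 s) by apply: perm_to_rem.
have := smin _ _ sE isT; rewrite big_seq1 eqxx.
rewrite (perm_size sE) (permP sE); case: (rem 0 s) => [|? ? /(_ isT)] //= _.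
by rewrite eqxx N2.
Qed.

(** * Atoms of a Krull monoid as minimal zero-sum sequences of classes *)

Section Transfer.
Variables (H : ccMonoidType) (P : choiceType).
Variable phi : monoid_hom H (free_abmon P).
Hypothesis phi_div : divisor_hom phi.

Definition of_seq (s : seq P) : free_abmon P := seq_mset s.
Definition prime_class (p : P) : class_group phi := divisor_class phi (fam_gen p).
Definition class_seq (A : free_abmon P) : seq (class_group phi) :=
  map prime_class (enum_mset A).

Lemma perm_of_seq s : perm_eq (enum_mset (of_seq s)) s.
Proof. exact: perm_eq_seq_mset. Qed.

Lemma of_seq_enum (A : free_abmon P) : of_seq (enum_mset A) = A.
Proof. exact: seq_mset_id. Qed.

Lemma of_seq_cat s t : of_seq (s ++ t) = (of_seq s * of_seq t)%g.
Proof. by apply/msetP => x; rewrite mset_seqE count_cat msetE2 !mset_seqE. Qed.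

Lemma of_seq_nil : of_seq [::] = 1%g.
Proof. by apply/msetP => x; rewrite mset_seqE mset0E. Qed.

Lemma eq_of_seq s t : perm_eq s t -> of_seq s = of_seq t.
Proof. by move=> st; apply/eq_seq_msetP. Qed.

Lemma enum_mul (A B : free_abmon P) :
  perm_eq (enum_mset (A * B)%g) (enum_mset A ++ enum_mset B).
Proof. by rewrite -{1}(of_seq_enum A) -{1}(of_seq_enum B) -of_seq_cat perm_of_seq. Qed.

Lemma divisor_classM : {morph divisor_class phi : A B / (A * B)%g >-> A + B}.
Proof.
move=> A B; rewrite /divisor_class.
have -> : mk_frac (A * B)%g 1%g = mk_frac A 1%g + mk_frac B 1%g :> quot_group _.
  by rewrite [RHS]qg_addE mulg1.
exact: Quotient.pi_add.
Qed.

Lemma divisor_class1 : divisor_class phi 1%g = 0.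
Proof.
by apply: (addrI (divisor_class phi 1%g)); rewrite -divisor_classM mulg1 addr0.
Qed.

Lemma divisor_classE A : divisor_class phi A = \sum_(g <- class_seq A) g.
Proof.
rewrite big_map -{1}(of_seq_enum A); elim: (enum_mset A) => [|p s IHs].
  by rewrite big_nil of_seq_nil divisor_class1.
rewrite big_cons -cat1s of_seq_cat divisor_classM IHs; congr (divisor_class _ _ + _).
by apply/msetP => x; rewrite mset_seqE msetnE /= addn0 eq_sym; case: eqP.
Qed.

(** A trivial class makes [A] a quotient of some [phi a] by some [phi b]; then [phi b] divides
    [phi a], and the divisor homomorphism moves the quotient into [H]. *)
Lemma divisor_class_eq0 A : divisor_class phi A = 0 <-> exists a, A = phi a.
Proof.
have divE : (divisor_class phi A == 0) = (mk_frac A 1%g \in principal phi).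
  rewrite -divisor_class1 /divisor_class -(Quotient.idealrBE (principal phi)).
  by rewrite [mk_frac 1%g 1%g](_ : _ = 0) ?subr0.
split=> [/eqP|[a AE]].
  rewrite divE => /asboolP[a [b /mk_fracP]]; rewrite mulg1 => aE.
  have [c aE'] : mdivides b a by apply: phi_div; exists A; rewrite -aE cmulgC.
  exists c; apply: (@cmulgI _ (phi b)).
  by rewrite -gmulfM -aE' -aE cmulgC.
apply/eqP; rewrite divE; apply/asboolP; exists a, 1%g.
by rewrite AE gmulf1.
Qed.

Lemma free_abmon_unit (A B : free_abmon P) : (A * B = 1)%g -> A = 1%g.
Proof.
move=> AB; apply/msetP => x; have /msetP/(_ x) := AB.
by rewrite msetE2 mset0E; case: (A x).
Qed.

Lemma phi_unit a : munit a <-> phi a = 1%g.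
Proof.
split=> [[b ab1]|a1].
  have : (phi a * phi b = 1)%g by rewrite -gmulfM ab1 gmulf1.
  exact: free_abmon_unit.
have : mdivides (phi a) (phi 1%g) by exists 1%g; rewrite gmulf1 a1 mulg1.
by move=> /phi_div[b b1]; exists b.
Qed.

Lemma class_seq_nil A : class_seq A = [::] <-> A = 1%g.
Proof.
split=> [AE|->]; last by rewrite /class_seq [enum_mset _]enum_mset0.
have : enum_mset A = [::] by move: AE; rewrite /class_seq; case: (enum_mset A).
by move=> AE'; rewrite -[A]of_seq_enum AE' of_seq_nil.
Qed.

Lemma class_seqM A B : perm_eq (class_seq (A * B)%g) (class_seq A ++ class_seq B).
Proof. by rewrite -map_cat perm_map // enum_mul. Qed.

Lemma phi_inj_unit a b : phi a = phi b -> exists2 c, munit c & b = (a * c)%g.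
Proof.
move=> ab; have [c bE] : mdivides a b by apply: phi_div; exists 1%g; rewrite mulg1.
exists c => //; apply/phi_unit; move: ab; rewrite bE gmulfM.
by rewrite -{1}[phi a]mulg1 => /cmulgI.
Qed.

(** A zero-sum part of the class sequence comes from a divisor of [phi u] with trivial class, that
    is, from an element of [H]. Splittings into zero-sum parts are therefore factorizations of [u]
    up to a unit. *)
Lemma matomE u : matom u <->
  min_zero_sum_seq (prime_classes phi) (class_seq (phi u)).
Proof.
split=> [[u_nunit u_atom]|[u0 _ _ u_min]].
  split.
  - by apply/eqP => /class_seq_nil/phi_unit.
  - by move=> g /mapP[p _ ->]; exists p.
  - by rewrite -divisor_classE; apply/divisor_class_eq0; exists u.
  move=> t v /perm_map_cat_lift[s1 [s2 [us s1E s2E]]] t0 v0; apply/eqP => t_sum.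
  have class_of_seq s : perm_eq (class_seq (of_seq s)) (map prime_class s).
    by rewrite perm_map // perm_of_seq.
  have uE : phi u = (of_seq s1 * of_seq s2)%g.
    by rewrite -of_seq_cat -(eq_of_seq us) of_seq_enum.
  have s1_0 : divisor_class phi (of_seq s1) = 0.
    by rewrite divisor_classE (perm_big _ (class_of_seq _)) s1E.
  have s2_0 : divisor_class phi (of_seq s2) = 0.
    have : divisor_class phi (phi u) = 0 by apply/divisor_class_eq0; exists u.
    by rewrite uE divisor_classM s1_0 add0r.
  have [a aE] := (divisor_class_eq0 _).1 s1_0.
  have [b bE] := (divisor_class_eq0 _).1 s2_0.
  have nil_of s w : map prime_class s = w -> of_seq s = 1%g -> w = [::].
    move=> <- s1'; apply/eqP; rewrite -size_eq0 -(perm_size (class_of_seq s)).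
    by rewrite s1' size_eq0; apply/eqP/class_seq_nil.
  have : phi (a * b)%g = phi u by rewrite gmulfM -aE -bE.
  case/phi_inj_unit => c /phi_unit c1 uE'.
  have [/phi_unit a1|/phi_unit] : munit a \/ munit (b * c)%g.
    by apply: u_atom; rewrite mulgA.
    by rewrite (nil_of _ _ s1E) ?aE in t0.
  rewrite gmulfM c1 mulg1 -bE => b1.
  by rewrite (nil_of _ _ s2E) in v0.
split=> [/phi_unit/class_seq_nil uE|a b uE]; first by rewrite uE in u0.
have := u_min _ _ (_ : perm_eq _ (class_seq (phi a) ++ class_seq (phi b))).
rewrite uE gmulfM class_seqM => /(_ isT) ab_min.
have [/class_seq_nil/phi_unit a1|a1] := eqVneq (class_seq (phi a)) [::].
  by left.
right; apply/phi_unit/class_seq_nil/eqP; apply: contraT => b1.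
have /eqP[] := ab_min a1 b1; rewrite -divisor_classE; apply/divisor_class_eq0.
by exists a.
Qed.

End Transfer.

Lemma min_zero_sum_opp (G : zmodType) (G0 : set G) s :
  (forall g, G0 g -> G0 (- g)) -> min_zero_sum_seq G0 s ->
  min_zero_sum_seq G0 (map -%R s).
Proof.
move=> oppG [s0 sG ssum smin]; split.
- by rewrite -size_eq0 size_map size_eq0.
- by move=> _ /mapP[g gs ->]; apply/oppG/sG.
- by rewrite big_map sumrN ssum oppr0.
move=> t u /perm_map_cat_lift[s1 [s2 [ss <- <-]]] t0 u0.
rewrite big_map sumrN oppr_eq0; apply: (smin _ _ ss).
  by apply: contraNneq t0 => ->.
by apply: contraNneq u0 => ->.
Qed.

Lemma min_zero_sum_neq0 (G : zmodType) (G0 : set G) s x :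
  min_zero_sum_seq G0 s -> (2 <= size s)%N -> x \in s -> x != 0.
Proof.
move=> [_ _ _ smin] s2 xs.
have sE : perm_eq s ([:: x] ++ rem x s) by apply: perm_to_rem.
have := smin _ _ sE isT; rewrite big_seq1; apply.
by rewrite -size_eq0 size_rem // -lt0n; case: (size s) s2 => [|[]].
Qed.

Lemma min_zero_sum_pair (G : zmodType) (G0 : set G) x :
  G0 x -> G0 (- x) -> x != 0 -> min_zero_sum_seq G0 [:: x; - x].
Proof.
move=> Gx Gnx x0; split=> // [g||t u].
- by rewrite !inE => /orP[/eqP->|/eqP->].
- by rewrite big_cons big_seq1 subrr.
case: t u => [|y [|z t]] [|y' u] // xE _ _.
  rewrite big_seq1; have : y \in [:: x; - x] by rewrite (perm_mem xE) mem_head.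
  by rewrite !inE => /orP[/eqP->|/eqP->]; rewrite ?oppr_eq0.
by move: (perm_size xE); rewrite /= size_cat /= addnS.
Qed.

(** * Elements with two given lengths *)

Section Lengths.
Variables (H : ccMonoidType) (P : choiceType).
Variable phi : monoid_hom H (free_abmon P).
Hypothesis phi_div : divisor_hom phi.

(** This is [union_lengths] without the convention for groups, a relation symmetric and additive in
    the pair of lengths. *)
Definition share_lengths (k n : nat) : Prop :=
  exists a : H, lengths a k /\ lengths a n.

(** The unit disappears in the free monoid: [phi] maps units to 1 and identifies only associated
    elements. *)
Lemma lengthsE (a : H) n : lengths a n <->
  exists s : seq H, [/\ size s = n, forall u, u \in s -> matom u
    & phi a = (\prod_(u <- s) phi u)%g].
Proof.
have phi_prod (s : seq H) : phi (\prod_(u <- s) u)%g = (\prod_(u <- s) phi u)%g.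
  by elim: s => [|u s IHs]; rewrite ?big_nil ?gmulf1 // !big_cons gmulfM IHs.
split=> [[e [s [/(phi_unit phi_div) e1 s_atom ->]]]|[s [<- s_atom aE]]].
  exists (s : seq H); split; first exact: size_tuple.
    by move=> u /tnthP[i ->].
  by rewrite gmulfM e1 mul1g -phi_prod big_tuple.
have : phi (\prod_(u <- s) u)%g = phi a by rewrite phi_prod.
case/(phi_inj_unit phi_div) => e e_unit ->.
exists e, (in_tuple s); split=> // [i|]; first exact/s_atom/mem_tnth.
by rewrite cmulgC big_tnth.
Qed.

Lemma share_lengths_sym k n : share_lengths k n -> share_lengths n k.
Proof. by case=> a [ak an]; exists a. Qed.

Lemma share_lengthsD k n k' n' :
  share_lengths k n -> share_lengths k' n' -> share_lengths (k + k')%N (n + n')%N.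
Proof.
have lengthsD (a b : H) m m' : lengths a m -> lengths b m' ->
    lengths (a * b)%g (m + m')%N.
  move=> /lengthsE[s [<- s_atom aE]] /lengthsE[t [<- t_atom bE]].
  apply/lengthsE; exists (s ++ t); rewrite size_cat big_cat gmulfM aE bE; split=> //.
  by move=> u; rewrite mem_cat => /orP[/s_atom|/t_atom].
by move=> [a [ak an]] [b [bk bn]]; exists (a * b)%g; split; apply: lengthsD.
Qed.

Lemma share_lengths_refl (u : H) k : matom u -> share_lengths k k.
Proof.
move=> u_atom; exists (\prod_(v <- nseq k u) v)%g.
suff : lengths (\prod_(v <- nseq k u) v)%g k by [].
apply/lengthsE; exists (nseq k u); rewrite size_nseq; split=> //.
  by move=> v; rewrite mem_nseq => /andP[_ /eqP->].
by elim: k => [|k IHk]; rewrite ?big_nil ?gmulf1 // !big_cons gmulfM IHk.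
Qed.

(** Length plus multiplicity of 0 is an additive weight of class sequences. Atoms weigh between 2
    and [N], so the weight of [phi a] is at least $2n$ and at most $kN$. *)
Lemma share_lengths_bound N k n : (2 <= N)%N ->
  (forall s, min_zero_sum_seq (prime_classes phi) s -> (size s <= N)%N) ->
  share_lengths k n -> (2 * n <= k * N)%N.
Proof.
move=> N2 bnd [a [/lengthsE[s [<- s_atom sE]] /lengthsE[t [<- t_atom tE]]]].
pose w A := (size (class_seq phi A) + count_mem 0%R (class_seq phi A))%N.
have w1 : w 1%g = 0%N by rewrite /w (class_seq_nil phi 1%g).2.
have wM A B : w (A * B)%g = (w A + w B)%N.
  have AB := class_seqM phi A B.
  by rewrite /w (perm_size AB) (permP AB) size_cat count_cat addnACA.
have wprod (x : seq H) : w (\prod_(u <- x) phi u)%g = (\sum_(u <- x) w (phi u))%N.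
  by elim: x => [|u x IHx]; rewrite ?big_nil // !big_cons wM IHx.
have w_atom u : matom u -> (2 <= w (phi u) <= N)%N.
  by move=> /(matomE phi_div); apply: min_zero_sum_weight.
apply: (@leq_trans (w (phi a))).
  rewrite tE wprod mulnC -sum1_size big_distrl big_seq [leqRHS]big_seq /=.
  by apply: leq_sum => u /t_atom/w_atom/andP[].
rewrite sE wprod -sum1_size big_distrl big_seq [leqRHS]big_seq /=.
by apply: leq_sum => u /s_atom/w_atom/andP[_]; rewrite mul1n.
Qed.

Hypothesis classes_sym : prime_classes phi = oppset (prime_classes phi).

(** Length at least 2 excludes 0 from [s], so every pair of a class and its negative is a minimal
    zero-sum sequence. *)
Lemma share_lengths_2 s : min_zero_sum_seq (prime_classes phi) s ->
  (2 <= size s)%N -> share_lengths 2 (size s).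
Proof.
move=> s_min s2.
have [s0 sG ssum smin] := s_min.
have oppG g : prime_classes phi g -> prime_classes phi (- g).
  by move=> Gg; rewrite classes_sym; exists g.
have x_neq0 x : x \in s -> x != 0 by apply: min_zero_sum_neq0 s_min s2.
have opp_min : min_zero_sum_seq (prime_classes phi) (map -%R s).
  exact: min_zero_sum_opp.
have atom_of ps : min_zero_sum_seq (prime_classes phi) (map (prime_class phi) ps) ->
    exists2 u, matom u & phi u = of_seq ps.
  move=> ps_min.
  have ps_perm : perm_eq (class_seq phi (of_seq ps)) (map (prime_class phi) ps).
    by rewrite perm_map // perm_of_seq.
  have [|u uE] := (divisor_class_eq0 phi_div (of_seq ps)).1.
    by rewrite divisor_classE (perm_big _ ps_perm); case: ps_min.
  exists u => //; apply/(matomE phi_div); rewrite -uE.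
  by apply: min_zero_sum_perm ps_min; rewrite perm_sym.
(* The primes [ps] and [qs] represent [s] and its negative term by term, and [ws] collects the atoms
   formed by corresponding primes. *)
have [ps [qs [ws [psE qsE wsz ws_atom wsE]]]] : exists ps qs ws,
    [/\ map (prime_class phi) ps = s, map (prime_class phi) qs = map -%R s,
      size ws = size s, forall w, w \in ws -> matom w
      & (\prod_(w <- ws) phi w)%g = (of_seq ps * of_seq qs)%g].
  have : forall x, x \in s -> prime_classes phi x /\ x != 0.
    by move=> x xs; split; [apply: sG|apply: x_neq0].
  elim: (s) => [|x s' IHs] s'G.
    by exists [::], [::], [::]; rewrite big_nil of_seq_nil mulg1.
  have [|ps [qs [ws [psE qsE wsz ws_atom wsE]]]] := IHs.
    by move=> y ys; apply: s'G; rewrite inE ys orbT.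
  have [Gx x0] := s'G x (mem_head _ _).
  have [[p _ pE'] [q _ qE']] := (Gx, oppG _ Gx).
  have pE : prime_class phi p = x := pE'.
  have qE : prime_class phi q = - x := qE'.
  have [|u u_atom uE] := atom_of [:: p; q].
    by rewrite /= pE qE; apply: min_zero_sum_pair => //; apply: oppG.
  exists (p :: ps), (q :: qs), (u :: ws); split.
  - by rewrite /= psE pE.
  - by rewrite /= qsE qE.
  - by rewrite /= wsz.
  - by move=> w; rewrite inE => /orP[/eqP->|/ws_atom].
  rewrite big_cons wsE uE -!of_seq_cat; apply: eq_of_seq.
  by rewrite /= perm_cons -cat1s perm_catCA.
have [|u u_atom uE] := atom_of ps; first by rewrite psE.
have [|v v_atom vE] := atom_of qs; first by rewrite qsE.
exists (u * v)%g; split; apply/lengthsE.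
  exists [:: u; v]; split=> // [w|]; last by rewrite big_cons big_seq1 gmulfM.
  by rewrite !inE => /orP[/eqP->|/eqP->].
by exists ws; rewrite wsE gmulfM uE vE.
Qed.

End Lengths.

(** * Shape of unions of lengths, from closure properties of a relation *)

Section UnionsOfLengths.
Variables (Q : nat -> nat -> Prop) (D : nat).
Hypothesis D_ge3 : (3 <= D)%N.
Hypothesis Q_refl : forall n, Q n n.
Hypothesis Q_sym : forall k n, Q k n -> Q n k.
Hypothesis QD : forall k n k' n', Q k n -> Q k' n' -> Q (k + k')%N (n + n')%N.
Hypothesis Q23 : Q 2 3.
Hypothesis Q2D : Q 2 D.
Hypothesis Q_bound : forall k n, Q k n -> (2 * n <= k * D)%N.

Lemma union_mul k n m : Q k n -> Q (m * k)%N (m * n)%N.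
Proof. by move=> Qkn; elim: m => [|m IHm] //; rewrite !mulSn; apply: QD. Qed.

(* The pairs (2,D) move the second length in steps of D - 2; D copies of (2,3)
   fill the gaps between these steps. *)
Lemma union_interval n k :
  (n <= k)%N -> (k <= (n - 2 * D - 1) %/ 2 * D)%N -> Q n k.
Proof.
move=> nk k_le; have [->//|n_neqk] := eqVneq n k.
have [/eqP q0|q_gt0] := posnP ((n - 2 * D - 1) %/ 2)%N.
  by move: k_le n_neqk; rewrite (eqP q0) mul0n leqn0 => /eqP k0; lia.
(* After setting aside [D] copies of 2 and the parity [s], [m] copies of 2 remain. *)
pose m := (n %/ 2 - D)%N; pose s := (n %% 2)%N.
have nE : n = (2 * m + 2 * D + s)%N by rewrite /m /s; lia.
have m_ge : ((n - 2 * D - 1) %/ 2 <= m)%N by rewrite /m; lia.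
have k_le' : (k <= m * D)%N by apply: leq_trans k_le _; rewrite leq_mul2r m_ge orbT.
pose x := (k - n)%N; have kE : k = (n + x)%N by rewrite /x subnKC.
have x_le : (x <= m * (D - 2))%N.
  rewrite mulnBr; lia.
have D2 : (0 < D - 2)%N by lia.
pose a := (x %/ (D - 2))%N; pose j := (x %% (D - 2))%N.
have xE : x = (a * (D - 2) + j)%N by apply: divn_eq.
have a_le : (a <= m)%N by rewrite /a -(mulnK m D2) leq_div2r.
have j_le : (j <= D)%N by have := ltn_pmod x D2; rewrite /j; lia.
(* Of the [m] copies of 2, [a] grow to [D]; of the [D] reserved ones, [j] grow to 3. The total gain
   is [a * (D - 2) + j], which is [x]. *)
have -> : n = (a * 2 + ((m - a) * 2 + (j * 2 + ((D - j) * 2 + s))))%N by lia.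
have -> : k = (a * D + ((m - a) * 2 + (j * 3 + ((D - j) * 2 + s))))%N.
  rewrite kE nE xE mulnBr; have : (a * 2 <= a * D)%N by rewrite leq_mul2l; lia.
  by lia.
by do !apply: QD; try exact: Q_refl; apply: union_mul.
Qed.

Lemma union_structure : exists M, forall k, exists a b,
  [/\ (a <= b)%N, forall n, (a <= n <= b)%N -> Q k n
    & forall n, Q k n -> (a <= n + M)%N /\ (n <= b + M)%N].
Proof.
(* Rounding costs at most $2D+3$ in the smaller length, hence at most $(2D+3)D$ in the larger
   one. *)
exists ((2 * D + 3) * D)%N => k.
(* From [a] up to [k], [union_interval] applies with the roles of the two lengths exchanged; [minn]
   and [maxn] keep [k] inside the interval when [k] is small. *)
pose a := minn k (2 * (k %/ D) + 2 * D + 3)%N.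
pose b := maxn k ((k - 2 * D - 1) %/ 2 * D)%N.
have D_gt0 : (0 < D)%N by lia.
exists a, b; split=> [|n /andP[an nb]|n Qkn].
- by rewrite /a /b geq_min leq_maxl.
- have [kn|nk] := leqP k n.
    move: nb; rewrite leq_max => /orP[nk|]; last exact: union_interval.
    by have -> : n = k by lia.
  apply/Q_sym/union_interval; first exact: ltnW.
  have n_ge : (2 * (k %/ D) + 2 * D + 3 <= n)%N.
    by move: an; rewrite /a geq_min; case/orP => //; lia.
  apply: (@leq_trans ((k %/ D).+1 * D)%N); first exact/ltnW/ltn_ceil.
  rewrite leq_mul2r; apply/orP; right; lia.
split.
  have kn := Q_bound (Q_sym Qkn).
  have : (2 * (k %/ D) <= n)%N.
    rewrite -(leq_pmul2r D_gt0); apply: leq_trans kn.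
    by rewrite -mulnA leq_mul2l leq_trunc_div.
  have : (2 * D + 3 <= (2 * D + 3) * D)%N by rewrite leq_pmulr.
  by rewrite geq_min; lia.
have kn := Q_bound Qkn.
have : (k <= (k - 2 * D - 1) %/ 2 * 2 + 2 * D + 3)%N by lia.
move=> /(leq_mul (leqnn D)); rewrite [(D * k)%N]mulnC => kD.
have : ((k - 2 * D - 1) %/ 2 * D <= b)%N by rewrite leq_maxr.
by lia.
Qed.

End UnionsOfLengths.

Lemma min_zero_sum_subset (G : zmodType) (G0 G1 : set G) s :
  G0 `<=` G1 -> min_zero_sum_seq G0 s -> min_zero_sum_seq G1 s.
Proof. by move=> G01 [s0 sG ssum smin]; split=> // g /sG/G01. Qed.

Lemma min_zero_sum_triple (G : zmodType) (G0 : set G) x y :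
  G0 x -> G0 y -> G0 (- (x + y)) -> x != 0 -> y != 0 -> x + y != 0 ->
  min_zero_sum_seq G0 [:: x; y; - (x + y)].
Proof.
move=> Gx Gy Gxy x0 y0 xy0.
have sum0 : \sum_(g <- [:: x; y; - (x + y)]) g = 0.
  by rewrite !big_cons big_nil addr0 addrA subrr.
have neq0 a : a \in [:: x; y; - (x + y)] -> a != 0.
  by rewrite !inE => /or3P[] /eqP-> //; rewrite oppr_eq0.
split=> // [g|t u sE t0 u0]; first by rewrite !inE => /or3P[] /eqP->.
have := perm_size sE; rewrite size_cat; case: t t0 sE => [|a [|b t]] // _ sE.
  by rewrite big_seq1 neq0 // (perm_mem sE) mem_head.
case: u u0 sE => [|a' [|b' u]] // _ sE /=; last by lia.
have : a' != 0 by apply: neq0; rewrite (perm_mem sE) mem_cat mem_head orbT.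
move: sum0; rewrite (perm_big _ sE) big_cat /= big_seq1 => /eqP.
by rewrite addr_eq0 => /eqP->; rewrite oppr_eq0.
Qed.

(** * The Davenport constant as a supremum *)

Section NatSup.
Variable R : realType.
Implicit Types A : set nat.

Lemma nat_sup_ub A n : A n -> ((n%:R)%:E <= nat_sup R A)%E.
Proof. by move=> An; apply: ereal_sup_ubound; exists n. Qed.

Lemma nat_sup_le A (x : R) : (forall n, A n -> n%:R <= x) -> (nat_sup R A <= x%:E)%E.
Proof. by move=> Ax; apply: ge_ereal_sup => _ [n /Ax nx <-]; rewrite lee_fin. Qed.

Lemma nat_sup_max A n : A n -> (forall m, A m -> (m <= n)%N) ->
  nat_sup R A = (n%:R)%:E.
Proof.
move=> An n_max; apply/le_anti/andP; split; last exact: nat_sup_ub.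
by apply: nat_sup_le => m /n_max; rewrite ler_nat.
Qed.

Variables (G : zmodType) (G0 : set G).

Lemma davenport_ub s : min_zero_sum_seq G0 s -> ((size s)%:R%:E <= davenport R G0)%E.
Proof.
move=> /minimal_zero_sum_seq_mset s_min; apply: nat_sup_ub.
by exists (seq_mset s) => //; apply/perm_size/perm_eq_seq_mset.
Qed.

Lemma davenport_le (x : R) :
  (forall s, min_zero_sum_seq G0 s -> (size s)%:R <= x) -> (davenport R G0 <= x%:E)%E.
Proof.
by move=> bnd; apply: nat_sup_le => _ [S /minimal_zero_sum_enum S_min <-]; apply: bnd.
Qed.

Lemma davenport_attained N s0 :
  min_zero_sum_seq G0 s0 -> (forall s, min_zero_sum_seq G0 s -> (size s <= N)%N) ->
  exists s, [/\ min_zero_sum_seq G0 s, davenport R G0 = (size s)%:R%:E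
    & forall t, min_zero_sum_seq G0 t -> (size t <= size s)%N].
Proof.
move=> s0_min bnd.
pose p n := `[< exists2 s, min_zero_sum_seq G0 s & size s = n >].
have pex : exists n, p n by exists (size s0); apply/asboolP; exists s0.
have pbnd n : p n -> (n <= N)%N by move=> /asboolP[s /bnd + <-].
case: (ex_maxnP pex pbnd) => n /asboolP[s s_min <-] n_max.
have s_max t : min_zero_sum_seq G0 t -> (size t <= size s)%N.
  by move=> t_min; apply: n_max; apply/asboolP; exists t.
exists s; split=> //; apply/le_anti/andP; split; last exact: davenport_ub.
by apply: davenport_le => t /s_max; rewrite ler_nat.
Qed.

End NatSup.

(** The sequence $e_1, e_2, -(e_1+e_2)$ provides $\mathsf D\ge 3$ and, through its negative, an
    element with lengths 2 and 3. *)
Lemma pos_sums_triple (G : zmodType) r (e : 'I_r -> G) : (2 <= r)%N -> is_Zbasis e ->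
  exists2 s, min_zero_sum_seq (pos_sums e `|` oppset (pos_sums e)) s & size s = 3%N.
Proof.
case: r e => [|[|r]] // e _ /Zbasis_coordinates[f f_inj fE].
pose d0 (j : 'I_r.+2) := j == ord0; pose d1 (j : 'I_r.+2) := j == lift ord0 ord0.
pose d01 j := d0 j || d1 j.
have sumE : signed_sum e false d0 + signed_sum e false d1 = signed_sum e false d01.
  rewrite -big_split; apply: eq_bigr => j _ /=; rewrite -mulrnDr /d01 /d0 /d1.
  by have [->|] := eqVneq j ord0; rewrite ?addn0.
have memP sg (d : 'I_r.+2 -> bool) i : d i ->
    (pos_sums e `|` oppset (pos_sums e)) (signed_sum e sg d) /\ signed_sum e sg d != 0.
  move=> di; split; first by apply: signed_sum_mem; exists i.
  apply/eqP => /(congr1 f)/rowP/(_ i)/eqP.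
  by rewrite (signed_sum_coord fE) di mulr1 raddf0 mxE signr_eq0.
exists [:: signed_sum e false d0; signed_sum e false d1; signed_sum e true d01] => //.
have -> : signed_sum e true d01 = - (signed_sum e false d0 + signed_sum e false d1).
  by rewrite sumE.
have [p0 n0] := memP false d0 ord0 isT.
have [p1 n1] := memP false d1 (lift ord0 ord0) (eqxx _).
have [p2 _] := memP true d01 ord0 isT; have [_ n2] := memP false d01 ord0 isT.
by apply: min_zero_sum_triple; rewrite ?sumE.
Qed.

Lemma share_lengths_atom (H : ccMonoidType) (P : choiceType)
    (phi : monoid_hom H (free_abmon P)) k n :
  divisor_hom phi -> share_lengths H k.+1 n -> exists u : H, matom u.
Proof.
move=> phi_div [a [/(lengthsE phi_div)[[|u s] [// _ s_atom _]] _]].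
by exists u; apply: s_atom; rewrite mem_head.
Qed.

(** An atom shows that [H] is not a group, which rules out the convention. *)
Lemma union_lengthsE (H : ccMonoidType) (u : H) k n : matom u ->
  union_lengths H k n <-> share_lengths H k n.
Proof.
move=> [u_nunit _]; split=> [[[/(_ u)//]|[_ //]]|kn].
by right; split=> // /(_ u).
Qed.

Theorem theorem4p3 (R : realType) :
  (forall (H : ccMonoidType) (P : choiceType)
          (phi : monoid_hom H (free_abmon P))
          (r : nat) (e : 'I_r -> class_group phi),
    krull H ->
    divisor_theory phi ->
    (2 <= r)%N ->
    is_Zbasis e ->
    finite_set (prime_classes phi) ->
    prime_classes phi = oppset (prime_classes phi) ->
    pos_sums e `<=` prime_classes phi ->
    (exists M : nat, forall k : nat, (2 <= k)%N ->
       exists (L' Ls L'' : set nat) (a b : nat),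
         [/\ union_lengths H k = L' `|` Ls `|` L'',
             (a <= b)%N /\ Ls = [set n | (a <= n <= b)%N],
             L' `<=` [set n | (a <= n + M)%N /\ (n < a)%N]
           & L'' `<=` [set n | (b < n)%N /\ (n <= b + M)%N]]) /\
    (forall k : nat, (0 < k)%N ->
       [/\ rho R H (2 * k) = ((k%:R)%:E * davenport R (prime_classes phi))%E,
           ((k%:R * (fib (r + 2))%:R)%:E
              <= (k%:R)%:E * davenport R (prime_classes phi))%E,
           ((k%:R)%:E * davenport R (prime_classes phi) + 1
              <= rho R H (2 * k + 1))%E
         & (rho R H (2 * k + 1)
              <= (k%:R)%:E * davenport R (prime_classes phi)
                 + (2^-1)%:E * davenport R (prime_classes phi))%E])) /\
  (forall (r : nat) (G : zmodType) (e : 'I_r -> G),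
    (2 <= r)%N ->
    is_Zbasis e ->
    let G0 := pos_sums e `|` oppset (pos_sums e) in
    let B : R := (r + 2)%:R `^ ((r + 2)%:R / 2) in
    [/\ (((fib (r + 2))%:R)%:E <= davenport R G0)%E,
        (davenport R G0 <= ((2 ^+ r - r%:R - 1) / 2 ^+ r * B)%:E)%E
      & (2 ^+ r - r%:R - 1) / 2 ^+ r * B <= B]).
Proof.
split=> [H P phi r e _ [phi_div _] r2 eB Gfin Gsym posG|r G e r2 eB]; last first.
  have [f f_inj fE] := Zbasis_coordinates eB; split.
  - have [s s_min <-] := fib_min_zero_sum f_inj fE (ltnW r2).
    exact: davenport_ub.
  - by apply: davenport_le => s; apply: signed_min_zero_sum_bound.
  rewrite ler_piMl ?powR_ge0 // ler_pdivrMr ?exprn_gt0 // mul1r -addrA gerDl.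
  by rewrite -opprD oppr_le0 addr_ge0.
set G0 := prime_classes phi.
have subG : pos_sums e `|` oppset (pos_sums e) `<=` G0.
  move=> x [/posG //|[y /posG Gy <-]].
  by rewrite /G0 Gsym; exists y.
have [N N_bnd] := finite_min_zero_sum_bounded eB Gfin.
have [s3 /(min_zero_sum_subset subG) s3_min s3_size] := pos_sums_triple r2 eB.
have [sD [sD_min davE sD_max]] := davenport_attained R s3_min N_bnd.
set D := size sD in davE sD_max.
have D3 : (3 <= D)%N by rewrite -s3_size sD_max.
have Q23 : share_lengths H 2%N 3%N.
  by rewrite -s3_size; apply: share_lengths_2 s3_min _; rewrite ?s3_size.
have Q2D : share_lengths H 2%N D by apply: share_lengths_2 => //; apply: ltnW.
have [u u_atom] := share_lengths_atom phi_div Q23.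
have unionE k n := union_lengthsE k n u_atom.
have Q_refl k : share_lengths H k k by apply: (share_lengths_refl phi_div k u_atom).
have Q_bound k n : share_lengths H k n -> (2 * n <= k * D)%N.
  by apply: (share_lengths_bound phi_div (ltnW D3)).
have QD := share_lengthsD phi_div.
split.
  have [M M_P] := union_structure D3 Q_refl (@share_lengths_sym H) QD Q23 Q2D Q_bound.
  exists M => k _; have [a [b [ab ab_sub ab_bnd]]] := M_P k.
  exists [set n | union_lengths H k n /\ (n < a)%N], [set n | (a <= n <= b)%N],
    [set n | union_lengths H k n /\ (b < n)%N], a, b; split=> //.
  - apply/seteqP; split=> [n kn|n [[[]|]|[]] //]; last by move/ab_sub/unionE.
    have [na|an] := ltnP n a; first by left; left.
    have [bn|nb] := ltnP b n; first by right.
    by left; right; rewrite /= an nb.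
  - by move=> n [/unionE/ab_bnd[]].
  by move=> n [/unionE/ab_bnd[]].
move=> k k0.
(* Taking [k] copies of the pair (2, D) attains the general bound. *)
have Q2k : share_lengths H (2 * k)%N (k * D)%N.
  by rewrite mulnC; apply: (union_mul Q_refl QD).
split.
- rewrite davE -EFinM -natrM; apply: nat_sup_max; first exact/unionE.
  by move=> n /unionE/Q_bound; rewrite -mulnA leq_pmul2l.
- rewrite davE -EFinM lee_fin ler_wpM2l // ler_nat.
  have [f f_inj fE] := Zbasis_coordinates eB.
  have [s /(min_zero_sum_subset subG) s_min <-] := fib_min_zero_sum f_inj fE (ltnW r2).
  exact: sD_max.
(* One further atom adds 1 to both lengths. *)
- rewrite davE -EFinM -natrM -EFinD natr1; apply: nat_sup_ub; apply/unionE.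
  by have := QD _ _ _ _ Q2k (Q_refl 1%N); rewrite [(k * D + 1)%N]addn1.
rewrite davE -!EFinM -EFinD; apply: nat_sup_le => n /unionE/Q_bound n_le.
have : (2 * n)%:R <= ((2 * k + 1) * D)%:R :> R by rewrite ler_nat.
rewrite !natrM natrD natrM; lra.
Qed.
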